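(* For every nonempty open subset $\omega$ of $(0,\pi)^2$, there exists $C_\omega>0$ such that $$\int_\omega|\phi|^2\,dx\ \ge\ C_\omega\int_{[0,\pi]^2}|\phi|^2\,dx$$ for any eigenfunction $\phi$ of the standard Dirichlet Laplacian on $[0,\pi]^2$. As a consequence, setting $M=[0,\pi]^2$, one has $\inf_{\mu\in\mathcal{Q}(M)}\mu(\omega)>0$ for any nonempty open subset $\omega$ of $M$ (i.e. every local quantum limit of the Dirichlet Laplacian on the square has full support).
   Context: The standard (nonnegative) Dirichlet Laplacian on $[0,\pi]^2$ has eigenvalues $j^2+k^2$, $j,k\in\mathbb{N}^*=\{1,2,\dots\}$, with eigenfunctions $\sin(jx)\sin(ky)$; eigenfunctions may be complex-valued. $M=[0,\pi]^2$ is endowed with the normalized Lebesgue measure $\rho$. $\mathcal{Q}(M)$ is the set of local quantum limits: probability Radon measures on $M$ that are closure points (weak limits), as $\lambda\to+\infty$, of the probability measures $|\phi_\lambda|^2\rho$, where $\phi_\lambda$ is an eigenfunction of the Dirichlet Laplacian for the eigenvalue $\lambda$ with $\|\phi_\lambda\|_{L^2(M,\rho)}=1$. *)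

(* Defs.v *)
From HB Require Import structures.
From mathcomp Require Import all_boot all_order all_algebra.
From mathcomp Require Import complex.
From mathcomp Require Import all_classical all_reals all_analysis.

Set Implicit Arguments.
Unset Strict Implicit.
Unset Printing Implicit Defensive.

Import Order.TTheory GRing.Theory Num.Theory.
Import numFieldNormedType.Exports.

Local Open Scope classical_set_scope.
Local Open Scope ring_scope.

Section square.
Variable R : realType.

(* The plane with its product topology, its structure of normed module over R
   and its product (= Borel) sigma-algebra. *)
Definition plane := (measurableTypeR R * measurableTypeR R)%type.

Definition open_square : set (R * R) :=
  [set p | 0 < p.1 < pi /\ 0 < p.2 < pi].

Definition closed_square : set (R * R) :=
  [set p | 0 <= p.1 <= pi /\ 0 <= p.2 <= pi].

Definition sqmod (z : R[i]) : R := ComplexField.Normc.normc z ^+ 2.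

Definition C2_on (U : set (R * R)) (f : R * R -> R) : Prop :=
  forall p, U p ->
    {for p, continuous f} /\
    forall v w : R * R,
      [/\ derivable f p v, {for p, continuous ('D_v f)},
          derivable ('D_v f) p w & {for p, continuous ('D_w ('D_v f))}].

Definition laplacian (f : R * R -> R) (p : R * R) : R :=
  'D_((1, 0) : R * R) ('D_((1, 0) : R * R) f) p +
  'D_((0, 1) : R * R) ('D_((0, 1) : R * R) f) p.

(* A complex-valued function is regular (resp. satisfies the real linear
   equation) iff its real and imaginary parts do. Only the values of phi on
   the closed square matter. *)
Definition dirichlet_eigenfunction (lambda : R) (phi : R * R -> R[i]) : Prop :=
  [/\ {within closed_square, continuous (fun p => complex.Re (phi p))} /\
      {within closed_square, continuous (fun p => complex.Im (phi p))},
      C2_on open_square (fun p => complex.Re (phi p)) /\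
      C2_on open_square (fun p => complex.Im (phi p)),
      forall p, open_square p ->
        - laplacian (fun q => complex.Re (phi q)) p
          = lambda * complex.Re (phi p) /\
        - laplacian (fun q => complex.Im (phi q)) p
          = lambda * complex.Im (phi p),
      forall p, (closed_square `\` open_square) p -> phi p = 0 &
      exists2 p, closed_square p & phi p != 0].

Definition area : {measure set plane -> \bar R} :=
  (@lebesgue_measure R \x @lebesgue_measure R)%E.

Fact invpi2_ge0 : 0 <= (pi ^+ 2 : R)^-1.
Proof. by rewrite invr_ge0 exprn_ge0// pi_ge0. Qed.

(* Normalized so that rho closed_square = 1; it is only used on subsets of the
   closed square. *)
Definition rho : {measure set plane -> \bar R} := mscale (NngNum invpi2_ge0) area.

(* Probability measures on the closed square are encoded as Borel probability
   measures on the plane giving full mass to the square (they are automatically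
   Radon). mu is a closure point of the measures |phi|^2 rho, as lambda tends to
   +oo, for the weak topology: every basic weak neighbourhood of mu, given by
   finitely many continuous functions on the square and a radius eps, contains
   such measures for arbitrarily large lambda. *)
Definition local_quantum_limit (mu : probability plane R) : Prop :=
  mu closed_square = 1%E /\
  forall (Lambda : R) (n : nat) (f : 'I_n -> (R * R -> R)) (eps : R),
    (forall i, {within closed_square, continuous (f i)}) -> 0 < eps ->
    exists (lambda : R) (phi : R * R -> R[i]),
      [/\ Lambda <= lambda,
          dirichlet_eigenfunction lambda phi,
          (\int[rho]_(p in closed_square) (sqmod (phi p))%:E = 1)%E &
          forall i : 'I_n,
            `| \int[rho]_(p in closed_square) (f i p * sqmod (phi p))
               - \int[mu]_(p in closed_square) f i p | < eps].

Definition quantum_limits : set (probability plane R) :=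
  [set mu | local_quantum_limit mu].

End square.

Arguments open_square R : clear implicits.
Arguments closed_square R : clear implicits.
Arguments area R : clear implicits.
Arguments rho R : clear implicits.
Arguments quantum_limits R : clear implicits.

(* Main.v *)
Require Import Defs.
From mathcomp Require Import all_boot all_order all_algebra.
From mathcomp Require Import complex.
From mathcomp Require Import all_classical all_reals all_analysis.
From mathcomp Require Import measurable_realfun ring lra zify.
Import Order.TTheory GRing.Theory Num.Theory.
Import numFieldNormedType.Exports.
Local Open Scope classical_set_scope.
Local Open Scope ring_scope.

(** Real and imaginary parts of an eigenfunction solve the same real problem,
    and the squared modulus is the sum of their squares, so it is enough to
    treat a real solution [f] of [- laplacian f = lambda * f].

    Such an [f] is a finite sum of [a_jk sin (j x) sin (k y)] over the points
    [(j, k)] of the circle [j ^ 2 + k ^ 2 = lambda].  Green's formula shows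
    that the other sine coefficients vanish ([eigen_fourier]).  Nothing is
    known about the gradient of [f] at the boundary, but the formula is
    applied to the dilated functions [f (c + r (z - c))], with [c] the centre
    of the square and [r < 1], which are smooth up to the boundary: only their
    boundary values appear, and these tend to [0] as [r] tends to [1].
    A continuous function whose sine coefficients all vanish is zero, as one
    sees by testing it against kernels concentrated at a point
    ([sine_complete]).

    Let a box around [(x0, y0)] be given.  With [kern n x0] the even
    trigonometric polynomial obtained from [cos ((x - x0) / 2) ^ (2 n)], the
    function [kern n x0 x * kern n y0 y - e] is at most [1] on the box, and at
    most [0] on the rest of the square when [e] is [peak n d], with [d] the
    half-side of the box; this [e] is geometrically small in [n].  The integral
    of [f ^ 2] over the box is thus bounded below by a quadratic form in the
    coefficients, whose matrix couples two points of the circle only if a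
    reflection in the axes brings them within distance [n] of each other.
    A lattice point of a circle of radius much larger than [n ^ 3] has at most
    one other lattice point of the circle within distance [n]: three such
    points would span a triangle of area at least [1 / 2], too large for
    their mutual distances ([circle_close_eq]).  So each row of the
    matrix, expanded over the reflections, has at most one term besides the
    main one, and the explicit binomial
    Fourier coefficients of the kernels make the matrix diagonally dominant,
    with a margin that is only polynomially small in [n] ([exists_gap]).
    This gives a constant valid for all large [lambda]
    ([high_frequency_lower]).

    The remaining eigenvalues involve finitely many sines.  These are linearly
    independent on every interval, so their Gram form is positive definite and
    bounded below ([sin_form_lower]), and the bound passes to products
    ([low_frequency_lower]).

    For the quantum limits, a tent function supported in the open set and
    equal to [1] on a smaller box transfers the uniform lower bound to the
    weak limits ([local_quantum_limit_lower]). *)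

(** * Integration on boxes of the plane *)

Section plane_measure.
Context {R : realType}.
Implicit Types (a b c d : R).

Local Notation mu := (@lebesgue_measure R).

Definition box a b c d : set (R * R) := `[a, b] `*` `[c, d].

(** The sigma-algebra of the plane is the product one; it contains the open
    sets because such a set is a union of countably many squares with rational
    centres and radii. *)
Lemma plane_open_measurable (U : set (R * R)) :
  open U -> measurable (U : set (plane R)).
Proof.
move=> oU.
pose V (q : rat * rat * rat) : set (plane R) :=
  ball (ratr q.1.1 : R) (ratr q.2) `*` ball (ratr q.1.2 : R) (ratr q.2).
pose W q := if `[< V q `<=` U >] then V q else set0.
have -> : (U : set (plane R)) = \bigcup_q W q.
  apply/seteqP; split => [[x y] Uxy|z [q _]]; last first.
    by rewrite /W; case: asboolP => // + Vq; apply.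
  have /nbhs_ballP[e /= e0 He] : nbhs (x, y) U.
    by rewrite openE in oU; exact: oU.
  have e20 : 0 < e / 2 by rewrite divr_gt0.
  have [r] := rat_in_itvoo e20; rewrite in_itv /= => /andP[r0 re].
  have [s] : exists q, (ratr q : R) \in `]x - ratr r, x + ratr r[.
    by apply: rat_in_itvoo; lra.
  rewrite in_itv /= => /andP[s1 s2].
  have [t] : exists q, (ratr q : R) \in `]y - ratr r, y + ratr r[.
    by apply: rat_in_itvoo; lra.
  rewrite in_itv /= => /andP[t1 t2].
  exists (s, t, r) => //; rewrite /W.
  have -> : `[< V (s, t, r) `<=` U >].
    apply/asboolP => -[u v] [/=]; rewrite /ball /= => Hu Hv; apply: He.
    by split; rewrite /ball /=; move: Hu Hv; rewrite !ltr_norml => /andP[? ?] /andP[? ?];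
        apply/andP; split; lra.
  by split; rewrite /ball /= ltr_norml; apply/andP; split; lra.
apply: countable_bigcupT_measurable => [|q]; first exact: countableP.
rewrite /W; case: asboolP => // _.
by apply: measurableX; apply: open_measurable; exact: ball_open.
Qed.

Lemma plane_continuous_measurable (f : R * R -> R) :
  continuous f -> measurable_fun setT (f : plane R -> R).
Proof.
move=> /continuousP cf; apply: (measurability _ (RGenOpens.measurableE R)).
move=> _ [_ [a [b ->] <-]]; rewrite setTI.
by apply: plane_open_measurable; apply: cf; exact: interval_open.
Qed.

Lemma measurable_box a b c d : measurable (box a b c d : set (plane R)).
Proof. by apply: measurableX; exact: measurable_itv. Qed.

Lemma subset_box a b c d a' b' c' d' : a' <= a -> b <= b' -> c' <= c -> d <= d' ->
  box a b c d `<=` box a' b' c' d'.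
Proof.
move=> aa bb cc dd [x y] [] /=; rewrite !in_itv /= => /andP[ax xb] /andP[cy yd].
by split; rewrite /= in_itv /= ?(le_trans aa) ?(le_trans xb) ?(le_trans cc) ?(le_trans yd).
Qed.

Lemma compact_box a b c d : compact (box a b c d).
Proof. by apply: compact_setX; exact: segment_compact. Qed.

Lemma area_box a b c d : a <= b -> c <= d ->
  area R (box a b c d) = ((b - a) * (d - c))%:E.
Proof.
move=> ab cd; transitivity (mu `[a, b]%classic * mu `[c, d]%classic)%E.
  by apply: product_measure1E; exact: measurable_itv.
rewrite !lebesgue_measure_itv /= !lte_fin EFinM.
move: ab cd; rewrite !le_eqVlt => /orP[/eqP->|ab] /orP[/eqP->|cd];
  by rewrite ?ltxx ?ab ?cd ?subrr ?mul0e ?mule0 ?EFinB.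
Qed.

Lemma area_box_lty a b c d : (area R (box a b c d) < +oo)%E.
Proof.
have -> : area R (box a b c d) = (mu `[a, b]%classic * mu `[c, d]%classic)%E.
  by apply: product_measure1E; exact: measurable_itv.
rewrite !lebesgue_measure_itv /= !lte_fin; case: ifP => _; case: ifP => _;
  by rewrite ?mul0e ?mule0 -?EFinB -?EFinM ltry.
Qed.

Lemma bounded_box (f : R * R -> R) a b c d : continuous f ->
  exists2 K, 0 < K & forall z, box a b c d z -> `|f z| <= K.
Proof.
move=> cf.
have /compact_bounded[K [_ HK]] : compact (f @` box a b c d).
  have h := @continuous_compact _ _ f _ (continuous_subspaceT cf).
  exact: (h _ (compact_box a b c d)).
exists (`|K| + 1) => [|z Bz]; first by rewrite ltr_wpDl.
by apply: HK; [rewrite (le_lt_trans (ler_norm _))// ltrDl|exists z].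
Qed.

Lemma box_integrable (f : R * R -> R) a b c d : continuous f ->
  (area R).-integrable (box a b c d) (EFin \o f).
Proof.
move=> cf; apply: measurable_bounded_integrable.
- exact: measurable_box.
- exact: area_box_lty.
- by apply: measurable_funTS; exact: plane_continuous_measurable.
- have [K K0 HK] := bounded_box f a b c d cf.
  exists K; split; first exact: num_real.
  by move=> M KM z /HK /le_trans; apply; exact: ltW.
Qed.

Lemma fst_cont : continuous (fst : R * R -> R).
Proof. by move=> [x y]; exact: (@cvg_fst _ _ (nbhs x) (nbhs y)). Qed.

Lemma snd_cont : continuous (snd : R * R -> R).
Proof. by move=> [x y]; exact: (@cvg_snd _ _ (nbhs x) (nbhs y)). Qed.

Lemma pair_cont (T : topologicalType) (f g : T -> R) :
  continuous f -> continuous g -> continuous (fun w => (f w, g w) : R * R).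
Proof.
by move=> cf cg w; apply: (@cvg_pair _ _ _ _ (nbhs (f w)) (nbhs (g w)));
  [exact: cf|exact: cg].
Qed.

Lemma pairl_cont y : continuous (fun x : R => (x, y) : R * R).
Proof. by apply: pair_cont => x; [exact: cvg_id|exact: cvg_cst]. Qed.

Lemma pairr_cont x : continuous (fun y : R => (x, y) : R * R).
Proof. by apply: pair_cont => y; [exact: cvg_cst|exact: cvg_id]. Qed.

Lemma segment_integrable (f : R -> R) a b : continuous f ->
  mu.-integrable `[a, b] (EFin \o f).
Proof.
move=> cf; apply: continuous_compact_integrable; first exact: segment_compact.
exact: continuous_subspaceT.
Qed.

Lemma box_fubini12E (f : R * R -> R) a b c d : continuous f ->
  (\int[area R]_(z in box a b c d) (f z)%:E =
   \int[mu]_(x in `[a, b]) (\int[mu]_(y in `[c, d]) f (x, y))%:E)%E.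
Proof.
move=> cf; have If := box_integrable f a b c d cf.
have IF : (area R).-integrable setT ((EFin \o f) \_ (box a b c d)).
  apply/integrable_restrict => //; first exact: measurable_box.
  by rewrite setTI.
rewrite integral_mkcond -(integral12_prod_meas1 IF) [RHS]integral_mkcond.
apply: eq_integral => x _; rewrite /fubini_F !patchE.
have Ix : mu.-integrable `[c, d] (EFin \o (fun y => f (x, y))).
  by apply: segment_integrable => y; apply: continuous_comp;
    [exact: pairr_cont|exact: cf].
case: ifPn => xab.
  rewrite /Rintegral fineK; last first.
    by apply: integrable_fin_num => //; exact: measurable_itv.
  rewrite [RHS]integral_mkcond; apply: eq_integral => y _; rewrite !patchE.
  case: ifPn => [/set_mem[/= _ H]|/negP H]; first by rewrite mem_set.
  rewrite memNset// => H1; apply: H; apply: mem_set.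
  by split => //=; exact: set_mem xab.
rewrite integral0_eq// => y _; rewrite patchE memNset// => -[/= H _].
by move/negP: xab; apply; exact: mem_set.
Qed.

Lemma box_fubini21E (f : R * R -> R) a b c d : continuous f ->
  (\int[area R]_(z in box a b c d) (f z)%:E =
   \int[mu]_(y in `[c, d]) (\int[mu]_(x in `[a, b]) f (x, y))%:E)%E.
Proof.
move=> cf; have If := box_integrable f a b c d cf.
have IF : (area R).-integrable setT ((EFin \o f) \_ (box a b c d)).
  apply/integrable_restrict => //; first exact: measurable_box.
  by rewrite setTI.
rewrite integral_mkcond -(integral21_prod_meas1 IF) [RHS]integral_mkcond.
apply: eq_integral => y _; rewrite /fubini_G !patchE.
have Ix : mu.-integrable `[a, b] (EFin \o (fun x => f (x, y))).
  by apply: segment_integrable => x; apply: continuous_comp;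
    [exact: pairl_cont|exact: cf].
case: ifPn => xab.
  rewrite /Rintegral fineK; last first.
    by apply: integrable_fin_num => //; exact: measurable_itv.
  rewrite [RHS]integral_mkcond; apply: eq_integral => x _; rewrite !patchE.
  case: ifPn => [/set_mem[/= H _]|/negP H]; first by rewrite mem_set.
  rewrite memNset// => H1; apply: H; apply: mem_set.
  by split => //=; exact: set_mem xab.
rewrite integral0_eq// => x _; rewrite patchE memNset// => -[/= _ H].
by move/negP: xab; apply; exact: mem_set.
Qed.

Lemma box_fubini12 (f : R * R -> R) a b c d : continuous f ->
  \int[area R]_(z in box a b c d) f z =
  \int[mu]_(x in `[a, b]) \int[mu]_(y in `[c, d]) f (x, y).
Proof. by move=> cf; rewrite /Rintegral box_fubini12E. Qed.

Lemma box_fubini21 (f : R * R -> R) a b c d : continuous f ->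
  \int[area R]_(z in box a b c d) f z =
  \int[mu]_(y in `[c, d]) \int[mu]_(x in `[a, b]) f (x, y).
Proof. by move=> cf; rewrite /Rintegral box_fubini21E. Qed.

Lemma box_intM (f g : R -> R) a b c d : continuous f -> continuous g ->
  \int[area R]_(z in box a b c d) (f z.1 * g z.2) =
  (\int[mu]_(x in `[a, b]) f x) * (\int[mu]_(y in `[c, d]) g y).
Proof.
move=> cf cg; rewrite box_fubini12 /=; last first.
  move=> z; apply: cvgM.
    by apply: continuous_comp; [exact: fst_cont|exact: cf].
  by apply: continuous_comp; [exact: snd_cont|exact: cg].
under eq_Rintegral => x _.
  rewrite RintegralZl; [|exact: measurable_itv|exact: segment_integrable].
  over.
by rewrite RintegralZr; [|exact: measurable_itv|exact: segment_integrable].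
Qed.

Definition clamp a b x := Num.max a (Num.min x b).

Lemma clamp_cont a b : continuous (clamp a b).
Proof.
move=> x; apply: (@continuous_max _ _ (fun _ => a) (fun y => Num.min y b)).
  exact: cvg_cst.
by apply: (@continuous_min _ _ id (fun _ => b)); [exact: cvg_id|exact: cvg_cst].
Qed.

Lemma clamp_itv a b x : a <= b -> a <= clamp a b x <= b.
Proof. by move=> ab; rewrite /clamp le_max lexx ge_max ab ge_min lexx orbT. Qed.

Lemma clamp_id a b x : a <= x <= b -> clamp a b x = x.
Proof. by move=> /andP[ax xb]; rewrite /clamp min_l// max_r. Qed.

Definition box_clamp a b c d (z : R * R) : R * R :=
  (clamp a b z.1, clamp c d z.2).

Lemma box_clamp_in a b c d z : a <= b -> c <= d -> box a b c d (box_clamp a b c d z).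
Proof. by move=> ab cd; split; rewrite /= in_itv /= clamp_itv. Qed.

Lemma box_clamp_id a b c d z : box a b c d z -> box_clamp a b c d z = z.
Proof.
by case: z => x y []/=; rewrite !in_itv /= /box_clamp /= => Hx Hy; rewrite !clamp_id.
Qed.

(** Composition with the retraction onto a box replaces a function that is
    only continuous on the box by one that is continuous on the plane and has
    the same values on the box.  All integrands below are made globally
    continuous in this way. *)
Lemma box_clamp_continuous (f : R * R -> R) a b c d : a <= b -> c <= d ->
  {within box a b c d, continuous f} -> continuous (f \o box_clamp a b c d).
Proof.
move=> ab cd cf z V /= Vf.
have Az := box_clamp_in a b c d z ab cd.
have := cf (box_clamp a b c d z) V Vf.
rewrite /nbhs /= -nbhs_subspace_in// => H.
have cl : continuous (box_clamp a b c d).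
  by apply: pair_cont => w; apply: continuous_comp;
    do ?[exact: fst_cont|exact: snd_cont|exact: clamp_cont].
have := cl z _ H; rewrite /nbhs /=; apply: filterS => w /=; apply.
exact: box_clamp_in.
Qed.

Lemma segment_FTC (F f : R -> R) a b : a <= b ->
  {within `[a, b], continuous f} ->
  (forall x, a <= x <= b -> is_derive x 1 F (f x)) ->
  \int[mu]_(x in `[a, b]) f x = F b - F a.
Proof.
rewrite le_eqVlt => /orP[/eqP <- _ _|ab cf dF].
  by rewrite set_itv1 Rintegral_set1 subrr.
have cF x : a <= x <= b -> {for x, continuous F}.
  move=> /dF[dFx _]; apply: differentiable_continuous.
  exact/derivable1_diffP.
rewrite /Rintegral (continuous_FTC2 ab cf (F := F)) //=.
- split=> [x||].
  + by rewrite inE/= => /andP[/ltW ax /ltW xb]; have := dF x; rewrite ax xb => /(_ isT)[].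
  + by apply: cvg_at_right_filter; apply: cF; rewrite lexx ltW.
  + by apply: cvg_at_left_filter; apply: cF; rewrite lexx ltW.
- move=> x; rewrite in_itv /= => /andP[/ltW ax /ltW xb].
  by rewrite derive1E; have := dF x; rewrite ax xb => /(_ isT)[].
Qed.

End plane_measure.

(** * Continuity, linearity of the integral, trigonometric integrals *)

Section continuity.
Context {R : realType} {T : topologicalType}.
Implicit Types f g : T -> R.

Lemma eq_cont f g : (forall x, f x = g x) -> continuous f -> continuous g.
Proof. by move=> /funext ->. Qed.

Lemma contD f g : continuous f -> continuous g -> continuous (fun x => f x + g x).
Proof. by move=> cf cg x; apply: cvgD; [exact: cf|exact: cg]. Qed.

Lemma contN f : continuous f -> continuous (fun x => - f x).
Proof. by move=> cf x; apply: cvgN; exact: cf. Qed.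

Lemma contM f g : continuous f -> continuous g -> continuous (fun x => f x * g x).
Proof. by move=> cf cg x; apply: cvgM; [exact: cf|exact: cg]. Qed.

Lemma cont_cst (a : R) : continuous (fun _ : T => a).
Proof. by move=> x; exact: cvg_cst. Qed.

Lemma contX f n : continuous f -> continuous (fun x => f x ^+ n).
Proof.
move=> cf; elim: n => [|n IH]; first exact: cont_cst.
by apply: (@eq_cont (fun x => f x * f x ^+ n)) => [x|];
  [rewrite exprS|exact: contM].
Qed.

Lemma cont_comp f (g : R -> R) :
  continuous f -> continuous g -> continuous (fun x => g (f x)).
Proof. by move=> cf cg x; apply: continuous_comp; [exact: cf|exact: cg]. Qed.

Lemma cont_cos f : continuous f -> continuous (fun x => cos (f x)).
Proof. by move=> cf; apply: cont_comp => //; exact: continuous_cos. Qed.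

Lemma cont_sin f : continuous f -> continuous (fun x => sin (f x)).
Proof. by move=> cf; apply: cont_comp => //; exact: continuous_sin. Qed.

Lemma cont_sum (I : Type) (r : seq I) (P : pred I) (F : I -> T -> R) :
  (forall i, continuous (F i)) -> continuous (fun x => \sum_(i <- r | P i) F i x).
Proof.
move=> cF; elim: r => [|i r IH].
  by apply: (@eq_cont (fun=> 0)) => [x|]; [rewrite big_nil|exact: cont_cst].
apply: (@eq_cont (fun x => if P i then F i x + \sum_(j <- r | P j) F j x
  else \sum_(j <- r | P j) F j x)) => [x|]; first by rewrite big_cons.
by case: (P i) => //; exact: contD.
Qed.

End continuity.

Section continuity2.
Context {R : realType}.

Lemma cont_id : continuous (fun x : R => x).
Proof. by move=> x; exact: cvg_id. Qed.

Lemma cont_fst (f : R -> R) : continuous f -> continuous (fun z : R * R => f z.1).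
Proof. by move=> cf x; apply: continuous_comp; [exact: fst_cont|exact: cf]. Qed.

Lemma cont_snd (f : R -> R) : continuous f -> continuous (fun z : R * R => f z.2).
Proof. by move=> cf x; apply: continuous_comp; [exact: snd_cont|exact: cf]. Qed.

Lemma cont_pairl (f : R * R -> R) y : continuous f -> continuous (fun x => f (x, y)).
Proof.
by move=> cf x; apply: (@continuous_comp _ _ _ (fun x => (x, y)) f);
  [exact: pairl_cont|exact: cf].
Qed.

Lemma cont_pairr (f : R * R -> R) x : continuous f -> continuous (fun y => f (x, y)).
Proof.
by move=> cf y; apply: (@continuous_comp _ _ _ (fun y => (x, y)) f);
  [exact: pairr_cont|exact: cf].
Qed.

End continuity2.

(** Continuity, by induction on the syntax of the function. *)
Ltac cont := match goal with
  | H : continuous ?f |- continuous ?f => exact H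
  | |- continuous (fun x => @?f x + @?g x) => apply (@contD _ _ f g); cont
  | |- continuous (fun x => - @?f x) => apply (@contN _ _ f); cont
  | |- continuous (fun x => @?f x * @?g x) => apply (@contM _ _ f g); cont
  | |- continuous (fun x => @?f x ^+ ?n) => apply (@contX _ _ f n); cont
  | |- continuous (fun x => cos (@?f x)) => apply (@cont_cos _ _ f); cont
  | |- continuous (fun x => sin (@?f x)) => apply (@cont_sin _ _ f); cont
  | |- continuous (fun x => \sum_(i <- _ | _) @?f i x) =>
      apply (@cont_sum _ _ _ _ _ f); intro; cont
  | |- continuous (fun _ => ?a) => exact (@cont_cst _ _ a)
  | |- continuous (fun x => x) => exact cont_id
  | |- continuous fst => exact fst_cont
  | |- continuous snd => exact snd_cont
  | |- continuous (fun x => x.1) => exact fst_cont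
  | |- continuous (fun x => x.2) => exact snd_cont
  | |- continuous (fun x => _ x.1) => apply cont_fst; cont
  | |- continuous (fun x => _ x.2) => apply cont_snd; cont
  | |- continuous (fun x => ?f x) => change (continuous f); cont
  | |- forall _, _ => let H := fresh in intro H; first [exact: H | cont]
  | |- _ => idtac
  end.

Section integral_linear.
Context {R : realType}.
Local Notation mu := (@lebesgue_measure R).
Implicit Types (a b c d k : R).

Lemma seg_intD (f g : R -> R) a b : continuous f -> continuous g ->
  \int[mu]_(x in `[a, b]) (f x + g x) =
  \int[mu]_(x in `[a, b]) f x + \int[mu]_(x in `[a, b]) g x.
Proof.
by move=> cf cg; rewrite RintegralD; do ?[by []|exact: measurable_itv|exact:
    segment_integrable].
Qed.

Lemma seg_intZ k (f : R -> R) a b : continuous f ->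
  \int[mu]_(x in `[a, b]) (k * f x) = k * \int[mu]_(x in `[a, b]) f x.
Proof.
by move=> cf; rewrite RintegralZl; do ?[by []|exact: measurable_itv|exact:
    segment_integrable].
Qed.

Lemma seg_int_sum (I : Type) (r : seq I) (P : pred I) (F : I -> R -> R) a b :
  (forall i, continuous (F i)) ->
  \int[mu]_(x in `[a, b]) (\sum_(i <- r | P i) F i x) =
  \sum_(i <- r | P i) \int[mu]_(x in `[a, b]) F i x.
Proof.
move=> cF; elim: r => [|i r IH].
  under eq_Rintegral do rewrite big_nil.
  by rewrite big_nil Rintegral_cst ?mul0r//; exact: measurable_itv.
under eq_Rintegral do rewrite big_cons.
rewrite big_cons; case: ifP => // Pi.
by rewrite seg_intD ?IH//; exact: cont_sum.
Qed.

Lemma seg_int_le (f g : R -> R) a b : continuous f -> continuous g ->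
  (forall x, a <= x <= b -> f x <= g x) ->
  \int[mu]_(x in `[a, b]) f x <= \int[mu]_(x in `[a, b]) g x.
Proof.
move=> cf cg fg; apply: le_Rintegral; do ?[exact: measurable_itv|exact: segment_integrable].
by move=> x; rewrite /= in_itv /=; exact: fg.
Qed.

Lemma eq_seg_int (f g : R -> R) a b : (forall x, a <= x <= b -> f x = g x) ->
  \int[mu]_(x in `[a, b]) f x = \int[mu]_(x in `[a, b]) g x.
Proof.
by move=> fg; apply: eq_Rintegral => x /set_mem; rewrite /= in_itv /=; exact: fg.
Qed.

Lemma seg_int_cst k a b : a <= b -> \int[mu]_(x in `[a, b]) k = k * (b - a).
Proof.
move=> ab; rewrite Rintegral_cst//.
congr (_ * _); have := @lebesgue_measure_itv R `[a, b].
rewrite /= lte_fin => ->; case: ltP => //= ba.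
by apply/esym/eqP; rewrite subr_eq0 eq_le ab ba.
Qed.

Lemma box_intD (f g : R * R -> R) a b c d : continuous f -> continuous g ->
  \int[area R]_(z in box a b c d) (f z + g z) =
  \int[area R]_(z in box a b c d) f z + \int[area R]_(z in box a b c d) g z.
Proof.
by move=> cf cg; rewrite RintegralD; do ?[by []|exact: measurable_box|exact:
    box_integrable].
Qed.

Lemma box_intZ k (f : R * R -> R) a b c d : continuous f ->
  \int[area R]_(z in box a b c d) (k * f z) =
  k * \int[area R]_(z in box a b c d) f z.
Proof.
by move=> cf; rewrite RintegralZl; do ?[by []|exact: measurable_box|exact: box_integrable].
Qed.

Lemma box_int_sum (I : Type) (r : seq I) (P : pred I) (F : I -> R * R -> R) a b c d :
  (forall i, continuous (F i)) ->
  \int[area R]_(z in box a b c d) (\sum_(i <- r | P i) F i z) =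
  \sum_(i <- r | P i) \int[area R]_(z in box a b c d) F i z.
Proof.
move=> cF; elim: r => [|i r IH].
  under eq_Rintegral do rewrite big_nil.
  by rewrite big_nil Rintegral_cst ?mul0r//; exact: measurable_box.
under eq_Rintegral do rewrite big_cons.
rewrite big_cons; case: ifP => // Pi.
by rewrite box_intD ?IH//; exact: cont_sum.
Qed.

Lemma box_int_le (f g : R * R -> R) a b c d : continuous f -> continuous g ->
  (forall z, box a b c d z -> f z <= g z) ->
  \int[area R]_(z in box a b c d) f z <= \int[area R]_(z in box a b c d) g z.
Proof.
by move=> cf cg fg; apply: le_Rintegral; do ?[exact: measurable_box|exact: box_integrable].
Qed.

Lemma eq_box_int (f g : R * R -> R) a b c d : (forall z, box a b c d z -> f z = g z) ->
  \int[area R]_(z in box a b c d) f z = \int[area R]_(z in box a b c d) g z.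
Proof. by move=> fg; apply: eq_Rintegral => x /set_mem; exact: fg. Qed.

Lemma box_int_cst k a b c d : a <= b -> c <= d ->
  \int[area R]_(z in box a b c d) k = k * ((b - a) * (d - c)).
Proof.
by move=> ab cd; rewrite Rintegral_cst ?area_box//; exact: measurable_box.
Qed.

End integral_linear.

Section trig.
Context {R : realType}.
Local Notation mu := (@lebesgue_measure R).

Lemma is_derive_sin_affine (k e x : R) :
  is_derive x 1 (fun x => sin (k * (x - e))) (k * cos (k * (x - e))).
Proof.
have h : is_derive x 1 (fun x => k * (x - e)) k.
  have := @is_deriveZ _ _ _ (fun x => x - e) k x 1 1.
  rewrite /GRing.scale /= mulr1; apply.
  by apply: is_derive_eq; rewrite ?subr0//; exact: subr0.
have := @is_derive1_comp _ sin (fun x => k * (x - e)) x _ _ (is_derive_sin _) h.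
by rewrite mulrC.
Qed.

Lemma is_derive_cos_affine (k e x : R) :
  is_derive x 1 (fun x => cos (k * (x - e))) (- (k * sin (k * (x - e)))).
Proof.
have h : is_derive x 1 (fun x => k * (x - e)) k.
  have := @is_deriveZ _ _ _ (fun x => x - e) k x 1 1.
  rewrite /GRing.scale /= mulr1; apply.
  by apply: is_derive_eq; rewrite ?subr0//; exact: subr0.
have := @is_derive1_comp _ cos (fun x => k * (x - e)) x _ _ (is_derive_cos _) h.
by rewrite mulrC mulrN.
Qed.

Lemma sin_intpi (m : int) : sin (m%:~R * pi) = 0 :> R.
Proof.
have H n : sin (n%:R * pi) = 0 :> R.
  elim: n => [|n IH]; first by rewrite mul0r sin0.
  by rewrite -natr1 mulrDl mul1r sinDpi IH oppr0.
case: m => n; first exact: H.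
by rewrite NegzE mulrNz mulNr sinN H oppr0.
Qed.

Lemma int_cos (m : int) :
  \int[mu]_(x in `[0, pi]) cos (m%:~R * x) = (m == 0)%:R * pi.
Proof.
have [->|m0] := eqVneq m 0.
  under eq_Rintegral do rewrite mul0r cos0.
  by rewrite seg_int_cst ?pi_ge0// subr0.
have mR : m%:~R != 0 :> R by rewrite intr_eq0.
pose F (x : R) := m%:~R^-1 * sin (m%:~R * (x - 0)).
transitivity (F pi - F 0); last first.
  by rewrite /F !subr0 mulr0 sin0 sin_intpi !mulr0 subr0 mul0r.
apply: segment_FTC; first exact: pi_ge0.
  by apply: continuous_subspaceT; cont.
move=> x _.
have := @is_deriveZ _ _ _ _ m%:~R^-1 x 1 _ (is_derive_sin_affine m%:~R 0 x).
by rewrite /GRing.scale /= mulKf// subr0.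
Qed.

Lemma cosM_sum (x y : R) : cos x * cos y = (cos (x - y) + cos (x + y)) / 2.
Proof. by rewrite cosB cosD; field. Qed.

Lemma sinM_sum (x y : R) : sin x * sin y = (cos (x - y) - cos (x + y)) / 2.
Proof. by rewrite cosB cosD; field. Qed.

Lemma int_coscos (m l : int) :
  \int[mu]_(x in `[0, pi]) (cos (m%:~R * x) * cos (l%:~R * x)) =
  pi / 2 * ((m == l)%:R + (m == - l)%:R).
Proof.
under eq_Rintegral => x _.
  rewrite cosM_sum -mulrBl -mulrDl -intrB -intrD mulrC.
  over.
rewrite seg_intZ; last by cont.
rewrite seg_intD; [|by cont|by cont].
by rewrite !int_cos subr_eq0 addr_eq0; field.
Qed.

Lemma int_sinsin (i j : nat) :
  \int[mu]_(x in `[0, pi]) (sin (i.+1%:R * x) * sin (j.+1%:R * x)) =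
  pi / 2 * (i == j)%:R.
Proof.
under eq_Rintegral => x _.
  rewrite sinM_sum -mulrBl -mulrDl.
  rewrite (_ : i.+1%:R - j.+1%:R = (i.+1%:Z - j.+1%:Z)%:~R); last by rewrite intrB.
  rewrite (_ : i.+1%:R + j.+1%:R = (i.+1%:Z + j.+1%:Z)%:~R); last by rewrite intrD.
  rewrite -(mulN1r (cos (_%:~R * x))) mulrC.
  over.
rewrite seg_intZ; last by cont.
rewrite seg_intD; [|by cont|by cont].
rewrite seg_intZ; last by cont.
rewrite !int_cos subr_eq0.
have -> : (i.+1%:Z + j.+1%:Z == 0) = false by apply/negbTE; lia.
have -> : (i.+1%:Z == j.+1%:Z) = (i == j) by lia.
by rewrite mulr0n; field.
Qed.

(** The binomial expansion of [(e ^ (i s) + e ^ (- i s)) ^ N], written with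
    real terms. *)
Lemma cos_expn (N : nat) (s : R) :
  (2 * cos s) ^+ N = \sum_(i < N.+1) 'C(N, i)%:R * cos ((i.*2%:R - N%:R) * s).
Proof.
elim: N => [|N IH].
  by rewrite big_ord1 expr0 bin0 /= subrr mul0r cos0 mulr1.
rewrite exprSr {}IH mulr_suml.
pose g (i : nat) : R := cos ((i.*2%:R - N.+1%:R) * s).
have gE (i : nat) : cos ((i.*2%:R - N%:R) * s) * (2 * cos s) = g i + g i.+1.
  rewrite mulrCA cosM_sum mulrC divfK ?pnatr_eq0//.
  congr (cos _ + cos _); rewrite /g ?doubleS -?natr1 -!mul2n ?natrM; ring.
under eq_bigr do rewrite -mulrA gE mulrDr.
rewrite big_split /=.
rewrite [RHS]big_ord_recl /= bin0.
under [in RHS]eq_bigr => i _ do rewrite /bump /= add1n binS natrD mulrDl.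
rewrite big_split /= addrA; congr (_ + _).
transitivity (\sum_(i < N.+2) 'C(N, i)%:R * g i).
  by rewrite [RHS]big_ord_recr /= bin_small// mul0r addr0.
by rewrite big_ord_recl /= bin0.
Qed.

(** Also equal to [cos (t / 2) ^+ (2 * n)]: a nonnegative trigonometric
    polynomial of degree [n], concentrated near the multiples of [2 pi] when
    [n] is large. *)
Definition peak (n : nat) (t : R) := ((1 + cos t) / 2) ^+ n.

(** The Fourier coefficient of [peak n] at the frequencies [l] and [- l]; it
    vanishes for [n < l]. *)
Definition peak_coef (n : nat) (l : nat) : R := 'C(n.*2, n + l)%:R / 4 ^+ n.

Lemma peak_fourier n t : peak n t =
  (4 ^+ n)^-1 * \sum_(i < n.*2.+1) 'C(n.*2, i)%:R * cos ((i%:Z - n%:Z)%:~R * t).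
Proof.
have -> : \sum_(i < n.*2.+1) 'C(n.*2, i)%:R * cos ((i%:Z - n%:Z)%:~R * t) =
   (2 * cos (t / 2)) ^+ n.*2.
  rewrite cos_expn; apply: eq_bigr => i _; congr (_ * cos _).
  have dblR k : k.*2%:R = 2 * k%:R :> R by rewrite -mul2n natrM.
  by rewrite intrB -!pmulrn !dblR; field.
rewrite /peak -mul2n exprM.
have -> : cos t = cos (t / 2) ^+ 2 *+ 2 - 1.
  by rewrite -cos_mulr2n [in RHS]mulr2n -splitr.
rewrite -exprVn -exprMn; congr (_ ^+ n).
by rewrite -mulr_natr; field.
Qed.

(** The peak at [x0] averaged with its mirror image at [- x0].  On [[0, pi]]
    it is still concentrated near [x0], and being even it is a sum of cosines,
    so that its products with two sines have explicit integrals on the half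
    period [[0, pi]]. *)
Definition kern (n : nat) (x0 x : R) := (peak n (x - x0) + peak n (x + x0)) / 2.

Lemma kern_fourier n x0 x : kern n x0 x =
  (4 ^+ n)^-1 * \sum_(i < n.*2.+1) 'C(n.*2, i)%:R *
     cos ((i%:Z - n%:Z)%:~R * x0) * cos ((i%:Z - n%:Z)%:~R * x).
Proof.
rewrite /kern !peak_fourier -mulrDr -big_split /= -mulrA; congr (_ * _).
rewrite mulr_suml; apply: eq_bigr => i _.
rewrite -mulrDr -mulrA -mulrA; congr (_ * _).
by rewrite [RHS]mulrC cosM_sum mulrBr mulrDr.
Qed.

Lemma kern_cont n x0 : continuous (kern n x0).
Proof. by rewrite /kern /peak; cont. Qed.

Lemma sum_bin_delta N (k : nat) (g : nat -> R) :
  \sum_(i < N.+1) 'C(N, i)%:R * g i * (i == k :> nat)%:R = 'C(N, k)%:R * g k.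
Proof.
have [kN|Nk] := ltnP k N.+1; last first.
  rewrite bin_small// mul0r big1// => i _.
  by rewrite (_ : (i == k :> nat) = false) ?mulr0//; have := ltn_ord i; lia.
rewrite (bigD1 (Ordinal kN)) //= eqxx mulr1 big1 ?addr0// => i.
by rewrite -val_eqE /= => /negbTE ->; rewrite mulr0.
Qed.

(** By orthogonality of the cosines only the two terms of frequency [l] and
    [- l] of [kern_fourier] contribute, and they have the same coefficient. *)
Lemma int_kern_cos n x0 (l : int) :
  \int[mu]_(x in `[0, pi]) (kern n x0 x * cos (l%:~R * x)) =
  pi * (peak_coef n `|l|%N * cos (l%:~R * x0)).
Proof.
wlog l0 : l / exists k, l = Posz k => [H|].
  case: l => k; first by apply: H; exists k.
  rewrite NegzE abszN mulrNz mulNr cosN -(H (k.+1)); last by exists k.+1.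
  by apply: eq_Rintegral => x _; rewrite mulNr cosN.
case: l0 => k {l}->.
under eq_Rintegral => x _.
  rewrite kern_fourier -mulrA mulr_suml.
  under eq_bigr do rewrite -mulrA.
  over.
rewrite seg_intZ; last by cont.
rewrite seg_int_sum; last by move=> i; cont.
under eq_bigr => i _.
  rewrite seg_intZ; last by cont.
  rewrite int_coscos.
  rewrite (_ : (i%:Z - n%:Z == k) = (i == (n + k)%N :> nat)); last by lia.
  rewrite (_ : (i%:Z - n%:Z == - k%:Z)%:R = (k <= n)%N%:R * (i == (n - k)%N :> nat)%:R :>
      R); last first.
    by rewrite -natrM mulnb; congr (_%:R); lia.
  rewrite mulrCA mulrDr (mulrCA _ (_ <= _)%N%:R).
  over.
rewrite -mulr_sumr big_split /= -mulr_sumr.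
rewrite (sum_bin_delta _ _ (fun i : nat => cos ((i%:Z - n%:Z)%:~R * x0))).
rewrite (sum_bin_delta _ _ (fun i : nat => cos ((i%:Z - n%:Z)%:~R * x0))).
rewrite (_ : (n + k)%N%:Z - n%:Z = k%:Z); last by lia.
rewrite /peak_coef /=.
have [kn|nk] := leqP k n; last first.
  by rewrite bin_small ?mul0r ?mulr0 ?addr0 ?mulr0//; lia.
rewrite (_ : (n - k)%N%:Z - n%:Z = - k%:Z); last by lia.
rewrite mulrNz mulNr cosN mul1r.
rewrite (_ : 'C(n.*2, n - k) = 'C(n.*2, n + k)); last first.
  by rewrite -bin_sub; [congr ('C(_, _))|]; lia.
by field; rewrite expf_neq0.
Qed.

Lemma int_kern_sin n x0 (i j : nat) :
  \int[mu]_(x in `[0, pi]) (kern n x0 x * (sin (i%:R * x) * sin (j%:R * x))) =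
  pi / 2 * (peak_coef n (absz (i%:Z - j%:Z)) * cos ((i%:Z - j%:Z)%:~R * x0) -
            peak_coef n (absz (i%:Z + j%:Z)) * cos ((i%:Z + j%:Z)%:~R * x0)).
Proof.
have ck := @kern_cont n x0.
under eq_Rintegral => x _.
  rewrite sinM_sum -mulrBl -mulrDl.
  rewrite (_ : i%:R - j%:R = (i%:Z - j%:Z)%:~R); last by rewrite intrB.
  rewrite (_ : i%:R + j%:R = (i%:Z + j%:Z)%:~R); last by rewrite intrD.
  rewrite mulrA mulrBr mulrC -mulN1r.
  over.
rewrite seg_intZ; last by cont.
rewrite seg_intD; [|by cont|by cont].
rewrite seg_intZ; last by cont.
by rewrite !int_kern_cos; field.
Qed.

End trig.

(** * Lattice points on circles, diagonal dominance, binomial coefficients *)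

Section domain_monotonicity.
Context d (T : measurableType d) {R : realType} (mu : {measure set T -> \bar R}).

Lemma Rintegral_le_subset (B E : set T) (f : T -> R) :
  measurable B -> measurable E -> mu.-integrable E (EFin \o f) -> B `<=` E ->
  (forall x, E x -> ~ B x -> 0 <= f x) ->
  \int[mu]_(x in B) f x <= \int[mu]_(x in E) f x.
Proof.
move=> mB mE fE BE f0.
have -> : E = B `|` (E `\` B) by rewrite setDUK.
rewrite Rintegral_setU; last 4 first.
- exact: mB.
- exact: measurableD.
- by rewrite setDUK.
- by apply/disj_setPS => x [Bx [_]].
by rewrite lerDl; apply: Rintegral_ge0 => x [Ex nBx]; exact: f0.
Qed.

End domain_monotonicity.

Section lattice.

(** If [m], [m + v] and [m + w] lie on the circle of squared radius [L], then
    [4 D ^ 2 L = |v| ^ 2 |w| ^ 2 |v - w| ^ 2] with [D] the determinant of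
    [(v, w)]: this is the formula [a b c / (4 r)] for the area of a triangle
    inscribed in a circle of radius [r].  For integral vectors either [D = 0],
    and then [v = w], or [D ^ 2 >= 1], which bounds [L]. *)
Lemma circle_close_eq (m1 m2 v1 v2 w1 w2 L : int) (n : nat) :
  m1 ^+ 2 + m2 ^+ 2 = L ->
  (m1 + v1) ^+ 2 + (m2 + v2) ^+ 2 = L -> (m1 + w1) ^+ 2 + (m2 + w2) ^+ 2 = L ->
  `|v1| <= n%:Z -> `|v2| <= n%:Z -> `|w1| <= n%:Z -> `|w2| <= n%:Z ->
  (v1 != 0) || (v2 != 0) -> (w1 != 0) || (w2 != 0) ->
  8 * n%:Z ^+ 6 < L -> v1 = w1 /\ v2 = w2.
Proof.
move=> Hm Hv Hw lv1 lv2 lw1 lw2 v0 w0 HL.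
pose D := v1 * w2 - v2 * w1.
pose Nv := v1 ^+ 2 + v2 ^+ 2; pose Nw := w1 ^+ 2 + w2 ^+ 2.
pose E := (v1 - w1) ^+ 2 + (v2 - w2) ^+ 2.
have sq0 (x y : int) : (x != 0) || (y != 0) -> 0 < x ^+ 2 + y ^+ 2.
  by case/orP => h; [apply: ltr_wpDr|apply: ltr_wpDl];
    rewrite ?sqr_ge0// lt_def sqr_ge0 expf_neq0.
have sqle (x : int) (k : nat) : `|x| <= k%:Z -> x ^+ 2 <= k%:Z ^+ 2.
  by move=> h; rewrite -(real_normK (num_real x)) ler_sqr ?nnegrE.
have Nv0 : 0 < Nv by exact: sq0.
have Nw0 : 0 < Nw by exact: sq0.
have mv : 2 * (m1 * v1 + m2 * v2) = - Nv by rewrite /Nv; lra.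
have mw : 2 * (m1 * w1 + m2 * w2) = - Nw by rewrite /Nw; lra.
have D1 : 2 * D * m1 = - w2 * Nv + v2 * Nw.
  transitivity (w2 * (2 * (m1 * v1 + m2 * v2)) - v2 * (2 * (m1 * w1 + m2 * w2))).
    by rewrite /D; ring.
  by rewrite mv mw; ring.
have D2 : 2 * D * m2 = - v1 * Nw + w1 * Nv.
  transitivity (v1 * (2 * (m1 * w1 + m2 * w2)) - w1 * (2 * (m1 * v1 + m2 * v2))).
    by rewrite /D; ring.
  by rewrite mv mw; ring.
have key : 4 * D ^+ 2 * L = Nv * Nw * E.
  transitivity ((2 * D * m1) ^+ 2 + (2 * D * m2) ^+ 2); first by rewrite -Hm; ring.
  by rewrite D1 D2 /Nv /Nw /E; ring.
have [D0|D0] := eqVneq D 0.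
  move/esym/eqP: key; rewrite D0 expr0n /= mulr0 mul0r mulf_eq0 mulf_eq0.
  rewrite (gt_eqF Nv0) (gt_eqF Nw0) /= /E paddr_eq0 ?sqr_ge0// !sqrf_eq0 !subr_eq0.
  by case/andP => /eqP -> /eqP ->.
exfalso.
have D21 : 1 <= D ^+ 2.
  by rewrite -gtz0_ge1 lt_def sqr_ge0 andbT expf_neq0.
have Nvn : Nv <= 2 * n%:Z ^+ 2.
  by have := sqle _ _ lv1; have := sqle _ _ lv2; rewrite /Nv; lra.
have Nwn : Nw <= 2 * n%:Z ^+ 2.
  by have := sqle _ _ lw1; have := sqle _ _ lw2; rewrite /Nw; lra.
have En : E <= 8 * n%:Z ^+ 2.
  have h1 : (v1 - w1) ^+ 2 <= (n + n)%N%:Z ^+ 2.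
    by apply: sqle; rewrite (le_trans (ler_normB _ _))// PoszD lerD.
  have h2 : (v2 - w2) ^+ 2 <= (n + n)%N%:Z ^+ 2.
    by apply: sqle; rewrite (le_trans (ler_normB _ _))// PoszD lerD.
  rewrite /E; apply: le_trans (lerD h1 h2) _; rewrite PoszD.
  by rewrite le_eqVlt; apply/orP; left; apply/eqP; ring.
have : 4 * D ^+ 2 * L <= 32 * n%:Z ^+ 6.
  rewrite key; have -> : 32 * n%:Z ^+ 6 = (2 * n%:Z ^+ 2) * (2 * n%:Z ^+ 2) * (8 * n%:Z
      ^+ 2) by ring.
  apply: ler_pM => //; first by rewrite mulr_ge0// ltW.
    by rewrite addr_ge0 ?sqr_ge0.
  by apply: ler_pM => //; exact: ltW.
apply/negP; rewrite -ltNge.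
have L0 : 0 < L by apply: le_lt_trans HL; rewrite mulr_ge0// exprn_ge0.
have : 4 * 1 * L <= 4 * D ^+ 2 * L by rewrite ler_pM2r// ler_pM2l.
lra.
Qed.

End lattice.

Section diag_dominance.
Context {R : realFieldType} {I : finType}.
Implicit Types (V : I -> I -> R) (a : I -> R).

(** Gershgorin's bound for symmetric matrices: each off-diagonal term
    [a p * a q * V p q] is at least [- (a p ^ 2 + a q ^ 2) / 2 * |V p q|], and
    by symmetry the total loss is distributed over the rows. *)
Lemma diag_dominant_lower (S : pred I) V a (d : R) :
  (forall p q, V p q = V q p) ->
  (forall p, S p -> d <= V p p - \sum_(q | S q && (q != p)) `|V p q|) ->
  d * \sum_(p | S p) a p ^+ 2 <=
  \sum_(p | S p) \sum_(q | S q) a p * a q * V p q.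
Proof.
move=> symV dV.
pose W p q := if q != p then `|V p q| else 0.
have symW p q : W p q = W q p by rewrite /W eq_sym symV.
have rowE p : \sum_(q | S q && (q != p)) `|V p q| = \sum_(q | S q) W p q.
  by rewrite big_mkcondr.
apply: (@le_trans _ _ (\sum_(p | S p) (a p ^+ 2 * V p p -
    \sum_(q | S q) (a p ^+ 2 + a q ^+ 2) / 2 * W p q))).
  rewrite sumrB.
  have -> : \sum_(p | S p) \sum_(q | S q) (a p ^+ 2 + a q ^+ 2) / 2 * W p q =
      \sum_(p | S p) a p ^+ 2 * \sum_(q | S q) W p q.
    have -> : \sum_(p | S p) \sum_(q | S q) (a p ^+ 2 + a q ^+ 2) / 2 * W p q =
       \sum_(p | S p) \sum_(q | S q) a p ^+ 2 / 2 * W p q +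
       \sum_(p | S p) \sum_(q | S q) a q ^+ 2 / 2 * W p q.
      rewrite -big_split; apply: eq_bigr => p _.
      by rewrite -big_split; apply: eq_bigr => q _ /=; ring.
    rewrite [X in _ + X]exchange_big /= -big_split; apply: eq_bigr => p _.
    rewrite -big_split /= mulr_sumr; apply: eq_bigr => q _.
    by rewrite (symW q p); field.
  rewrite -sumrB mulr_sumr; apply: ler_sum => p Sp.
  rewrite -mulrBr mulrC ler_wpM2l ?sqr_ge0// -rowE; exact: dV.
apply: ler_sum => p Sp.
rewrite (bigD1 p) //= [X in _ <= X](bigD1 p) //=.
rewrite {1}/W eqxx /= mulr0 add0r -expr2 lerD2l -sumrN.
apply: ler_sum => q /andP[Sq qp].
rewrite /W qp lerNl.
have /ler_normlP[] : `|a p * a q * V p q| <= (a p ^+ 2 + a q ^+ 2) / 2 * `|V p q|.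
  rewrite normrM ler_wpM2r ?normr_ge0// normrM.
  rewrite -(real_normK (num_real (a p))) -(real_normK (num_real (a q))).
  have := sqr_ge0 (`|a p| - `|a q|); rewrite sqrrB; lra.
by [].
Qed.

Lemma sum_at_most_one (P : pred I) (h : I -> R) (K : R) : 0 <= K ->
  (forall x, P x -> 0 <= h x <= K) ->
  (forall x y, P x -> P y -> h x != 0 -> h y != 0 -> x = y) ->
  \sum_(x | P x) h x <= K.
Proof.
move=> K0 hK h1.
case: (pickP (fun x => P x && (h x != 0))) => [x /andP[Px hx]|H].
  rewrite (bigD1 x) //= big1 ?addr0; first by case/andP: (hK _ Px).
  move=> y /andP[Py yx]; apply/eqP; apply: contraNT yx => hy.
  by apply/eqP; exact: h1.
by rewrite big1// => x Px; have := H x; rewrite Px /= => /negbFE/eqP.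
Qed.

End diag_dominance.

Section coefs.
Context {R : realType}.
Local Notation pc := (@peak_coef R).

Lemma pc_ge0 n l : 0 <= pc n l.
Proof. by rewrite /peak_coef divr_ge0// exprn_ge0. Qed.

Lemma pc_large n l : (n < l)%N -> pc n l = 0.
Proof. by move=> nl; rewrite /peak_coef bin_small ?mul0r//; lia. Qed.

Lemma pcS n l : pc n l.+1 <= pc n l.
Proof.
rewrite /peak_coef ler_wpM2r ?invr_ge0 ?exprn_ge0// ler_nat.
rewrite -(leq_pmul2l (ltn0Sn (n + l))) addnS mul_bin_left leq_mul2r.
by apply/orP; right; lia.
Qed.

Lemma pc_decr n l m : (l <= m)%N -> pc n m <= pc n l.
Proof.
move=> /subnKC <-; elim: (m - l)%N => [|k IH]; first by rewrite addn0.
by rewrite addnS; apply: le_trans IH; exact: pcS.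
Qed.

Lemma pc1 n : pc n 1 = pc n 0 * n%:R / n.+1%:R.
Proof.
rewrite /peak_coef addn0 addn1.
have /(congr1 (fun k => k%:R : R)) := mul_bin_left n.*2 n.
rewrite !natrM (_ : (n.*2 - n)%N = n); last by lia.
move=> H; have n1 : n.+1%:R != 0 :> R by rewrite pnatr_eq0.
have e4 : (4 ^+ n : R) != 0 by rewrite expf_neq0.
apply: (mulfI n1); rewrite mulrA H; move: n1 e4.
move: n.+1%:R (4 ^+ n) => x y x0 y0.
by field; rewrite ?x0 ?y0.
Qed.

Lemma pc0_ge n : (n.*2.+1%:R)^-1 <= pc n 0.
Proof.
have H : \sum_(i < n.*2.+1) 'C(n.*2, i)%:R / 4 ^+ n = 1 :> R.
  rewrite -mulr_suml -natr_sum -[X in _ / X](natrX R 4 n).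
  have -> : (\sum_(i < n.*2.+1) 'C(n.*2, i) = 4 ^ n)%N.
    rewrite (_ : 4 = 2 ^ 2)%N// -expnM mul2n (_ : 2 = 1 + 1)%N// expnDn.
    by apply: eq_bigr => i _; rewrite !exp1n !muln1.
  by rewrite divff// natrX expf_neq0.
have : 1 <= \sum_(i < n.*2.+1) pc n 0.
  rewrite -[X in X <= _]H; apply: ler_sum => i _.
  have [ni|ni] := leqP n i.
    rewrite (_ : 'C(n.*2, i) = 'C(n.*2, n + (i - n)))%N; last by rewrite subnKC.
    exact: (@pc_decr n 0 (i - n)).
  rewrite (_ : 'C(n.*2, i) = 'C(n.*2, n + (n - i)))%N; last first.
    by rewrite -bin_sub; [congr ('C(_, _))|]; lia.
  exact: (@pc_decr n 0 (n - i)).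
rewrite sumr_const card_ord -[pc n 0 *+ _]mulr_natr => h.
by rewrite -[X in X <= _]mul1r ler_pdivrMr ?ltr0n.
Qed.

(** As [pc n 1 = pc n 0 * n / (n + 1)] and [pc n 0 >= 1 / (2 n + 1)], the
    difference of the first two terms is at least of order [n ^ -3], which
    exceeds [r ^ n] for large [n].  Multiples [n = 4 m] are convenient: the
    inequality [(1 / r) ^ m >= m h] of Bernoulli, with [h = 1 / r - 1], gives
    [r ^ n <= (m h) ^ -4]. *)
Lemma exists_gap (r : R) : 0 <= r < 1 ->
  exists n, 0 < pc n 0 ^+ 2 - pc n 0 * pc n 1 - r ^+ n.
Proof.
move=> /andP[r0 r1].
have [K K0 main] : exists2 K : R, 0 < K & forall m : nat, (0 < m)%N ->
    (K * m%:R ^+ 3)^-1 <= pc (4 * m) 0 ^+ 2 - pc (4 * m) 0 * pc (4 * m) 1.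
  exists 405 => [|m m0]; first lra.
  set n := (4 * m)%N.
  have -> : pc n 0 ^+ 2 - pc n 0 * pc n 1 = pc n 0 ^+ 2 / n.+1%:R.
    rewrite pc1; have : n.+1%:R != 0 :> R by rewrite pnatr_eq0.
    by rewrite -natr1 => n1; field.
  have m1 : 1 <= m%:R :> R by rewrite ler1n.
  have h1 : n.+1%:R <= 5 * m%:R :> R by rewrite -natrM ler_nat /n; lia.
  have h2 : n.*2.+1%:R <= 9 * m%:R :> R by rewrite -natrM ler_nat /n; lia.
  have h3 : (9 * m%:R)^-1 <= pc n 0.
    apply: le_trans (pc0_ge n); rewrite lef_pV2 ?posrE ?ltr0n// mulr_gt0//; lra.
  have -> : (405 * m%:R ^+ 3)^-1 = ((9 * m%:R)^-1) ^+ 2 / (5 * m%:R) :> R.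
    by field; apply/eqP; lra.
  apply: ler_pM.
  - by rewrite exprn_ge0// invr_ge0; lra.
  - by rewrite invr_ge0; lra.
  - by rewrite ler_sqr ?nnegrE ?pc_ge0// invr_ge0; lra.
  - by rewrite lef_pV2 ?posrE ?ltr0n//; lra.
have [r00|rn0] := eqVneq r 0.
  exists (4 * 1)%N; rewrite r00 expr0n /= subr0.
  by apply: lt_le_trans (main 1%N isT); rewrite invr_gt0 expr1n mulr1.
have rp : 0 < r by rewrite lt_def rn0.
pose h := r^-1 - 1.
have h0 : 0 < h by rewrite subr_gt0 invf_gt1.
have bern (m : nat) : 1 + m%:R * h <= (r^-1) ^+ m.
  have -> : r^-1 = 1 + h by rewrite /h; lra.
  elim: m => [|m IH]; first by rewrite mul0r addr0 expr0.
  rewrite exprSr; have : (1 + m%:R * h) * (1 + h) <= (1 + h) ^+ m * (1 + h).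
    by rewrite ler_pM2r//; lra.
  apply: le_trans; rewrite -natr1.
  have : 0 <= m%:R * h ^+ 2 by rewrite mulr_ge0// sqr_ge0.
  nra.
have [m Hm] : exists m : nat, K / h ^+ 4 < m%:R.
  by exists (Num.truncn (K / h ^+ 4)).+1; exact: truncnS_gt.
have h4 : 0 < h ^+ 4 by rewrite exprn_gt0.
have m0 : (0 < m)%N.
  by rewrite -(ltr0n R); apply: le_lt_trans Hm; rewrite divr_ge0// ltW.
exists (4 * m)%N; rewrite subr_gt0; apply: lt_le_trans (main m m0).
rewrite -[r ^+ _]invrK ltf_pV2 ?posrE; last 2 first.
- by rewrite invr_gt0 exprn_gt0.
- by rewrite mulr_gt0// exprn_gt0// ltr0n.
rewrite mulnC exprM -!exprVn.
have mR : 0 < m%:R :> R by rewrite ltr0n.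
apply: (@lt_le_trans _ _ ((m%:R * h) ^+ 4)); last first.
  rewrite lerXn2r ?nnegrE.
  - by [].
  - by rewrite mulr_ge0// ltW.
  - by rewrite exprn_ge0// invr_ge0.
  - by apply: le_trans (bern m); rewrite lerDr.
have -> : (m%:R * h) ^+ 4 = (m%:R * h ^+ 4) * m%:R ^+ 3 by ring.
by rewrite ltr_pM2r ?exprn_gt0// -ltr_pdivrMr.
Qed.

End coefs.

(** * Sine sums at high frequency *)

Lemma PoszX (m k : nat) : (m ^ k)%N%:Z = m%:Z ^+ k.
Proof. by elim: k => // k IH; rewrite expnS PoszM IH exprS. Qed.

Section sine_sums.
Context {R : realType}.
Local Notation mu := (@lebesgue_measure R).
Local Notation pc := (@peak_coef R).

Definition sine_mode (j k : nat) (z : R * R) : R :=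
  sin (j.+1%:R * z.1) * sin (k.+1%:R * z.2).

Definition sine_sum {N} (a : 'I_N * 'I_N -> R) (z : R * R) : R :=
  \sum_p a p * sine_mode p.1 p.2 z.

Lemma cont_sine_mode j k : continuous (sine_mode j k).
Proof. by rewrite /sine_mode; cont. Qed.

Lemma cont_sine_sum N (a : 'I_N * 'I_N -> R) : continuous (sine_sum a).
Proof. by rewrite /sine_sum /sine_mode; cont. Qed.

Lemma box_int_sine_sum N (a : 'I_N * 'I_N -> R) (f g : R -> R) x1 x2 y1 y2 :
  continuous f -> continuous g ->
  \int[area R]_(z in box x1 x2 y1 y2) (f z.1 * g z.2 * sine_sum a z ^+ 2) =
  \sum_p \sum_q a p * a q *
   ((\int[mu]_(x in `[x1, x2]) (f x * (sin (p.1.+1%:R * x) * sin (q.1.+1%:R * x)))) *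
    (\int[mu]_(y in `[y1, y2]) (g y * (sin (p.2.+1%:R * y) * sin (q.2.+1%:R * y))))).
Proof.
move=> cf cg.
pose F (p q : 'I_N * 'I_N) x := f x * (sin (p.1.+1%:R * x) * sin (q.1.+1%:R * x)).
pose G (p q : 'I_N * 'I_N) y := g y * (sin (p.2.+1%:R * y) * sin (q.2.+1%:R * y)).
have cF p q : continuous (F p q) by rewrite /F; cont.
have cG p q : continuous (G p q) by rewrite /G; cont.
have cFG p q : continuous (fun z : R * R => F p q z.1 * G p q z.2).
  by apply: contM; [exact: cont_fst|exact: cont_snd].
transitivity (\int[area R]_(z in box x1 x2 y1 y2)
    \sum_p \sum_q a p * a q * (F p q z.1 * G p q z.2)).
  apply: eq_Rintegral => z _; rewrite expr2 /sine_sum mulr_suml mulr_sumr.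
  apply: eq_bigr => p _; rewrite mulr_sumr mulr_sumr; apply: eq_bigr => q _.
  by rewrite /sine_mode /F /G; ring.
rewrite box_int_sum; last by cont.
apply: eq_bigr => p _; rewrite box_int_sum; last by cont.
apply: eq_bigr => q _; rewrite box_intZ//.
by rewrite box_intM.
Qed.

(** The sine modes are orthogonal on the whole square. *)
Lemma sine_sum_parseval N (a : 'I_N * 'I_N -> R) :
  \int[area R]_(z in box 0 pi 0 pi) (sine_sum a z ^+ 2) =
  (pi / 2) ^+ 2 * \sum_p a p ^+ 2.
Proof.
transitivity (\int[area R]_(z in box 0 pi 0 pi) (1 * 1 * sine_sum a z ^+ 2)).
  by apply: eq_Rintegral => z _; rewrite !mul1r.
rewrite (@box_int_sine_sum _ _ (fun=> 1) (fun=> 1)); [|by cont|by cont].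
rewrite mulr_sumr; apply: eq_bigr => -[i j] _.
rewrite (bigD1 (i, j)) //= big1 ?addr0.
  have H (k : nat) : \int[mu]_(x in `[0, pi]) (1 * (sin (k.+1%:R * x) * sin (k.+1%:R *
      x))) = pi / 2.
    transitivity (\int[mu]_(x in `[0, pi]) ((sin (k.+1%:R * x) * sin (k.+1%:R * x)))).
      by apply: eq_Rintegral => x _; rewrite mul1r.
    by rewrite int_sinsin eqxx mulr1.
  by rewrite !H; ring.
move=> [i' j'] /= ne.
have H (k l : nat) : \int[mu]_(x in `[0, pi]) (1 * (sin (k.+1%:R * x) * sin (l.+1%:R *
    x))) = pi / 2 * (k == l)%:R.
  rewrite -int_sinsin.
  by apply: eq_Rintegral => x _; rewrite mul1r.
rewrite !H; have [ii|] := eqVneq (i : nat) i'; last by rewrite mulr0 mul0r mulr0.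
have [jj|] := eqVneq (j : nat) j'; last by rewrite !mulr0.
by case/eqP: ne; congr (_, _); apply: val_inj.
Qed.

Lemma pc_cos_le n l (t : R) : `|pc n l * cos t| <= pc n l.
Proof.
by rewrite normrM (ger0_norm (pc_ge0 n l)) ler_piMr ?pc_ge0 ?cos_max.
Qed.

(** The quadratic form of the high frequency estimate.  Up to the factor
    [(pi / 2) ^ 2], [V p q] is the integral over the square of
    [(kern n x0 x * kern n y0 y - e)] times the modes [p] and [q]; it factors
    into the one-dimensional integrals [A].  The four sign choices in the
    product of two factors [A] correspond to the reflections of [q] in the
    axes: [h p (q, b)] bounds the contribution of the reflection [b] of [q],
    and depends on its difference with [p] only.  Only the points of the
    circle [S] matter. *)
Section row_sums.
Variables (n N L : nat) (x0 y0 e : R).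
Hypothesis HL : (8 * n ^ 6 < L)%N.
Let I : finType := ('I_N * 'I_N)%type.
Let S (p : I) := (p.1.+1 ^ 2 + p.2.+1 ^ 2 == L)%N.

Let A (t : R) (i j : nat) :=
  pc n (absz (i%:Z - j%:Z)) * cos ((i%:Z - j%:Z)%:~R * t) -
  pc n (absz (i%:Z + j%:Z)) * cos ((i%:Z + j%:Z)%:~R * t).

Let V (p q : I) := A x0 p.1.+1 q.1.+1 * A y0 p.2.+1 q.2.+1 - e * (p == q)%:R.

Let sgn (b : bool) (j : nat) : int := if b then - j%:Z else j%:Z.

Let h (p : I) (x : I * (bool * bool)) : R :=
  pc n (absz (p.1.+1%:Z - sgn x.2.1 x.1.1.+1)) *
  pc n (absz (p.2.+1%:Z - sgn x.2.2 x.1.2.+1)).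

Let h_ge0 p x : 0 <= h p x.
Proof. by rewrite /h mulr_ge0// pc_ge0. Qed.

Let A_sym t i j : A t i j = A t j i.
Proof.
rewrite /A [i%:Z + j%:Z]addrC distnC; congr (_ * _ - _).
by rewrite -(opprB j%:Z i%:Z) mulrNz mulNr cosN.
Qed.

Let V_sym p q : V p q = V q p.
Proof. by rewrite /V eq_sym A_sym (A_sym y0). Qed.

Let normA t i j : `|A t i j| <= pc n (absz (i%:Z - j%:Z)) + pc n (absz (i%:Z + j%:Z)).
Proof.
by rewrite /A; apply: le_trans (ler_normB _ _) _; apply: lerD; exact: pc_cos_le.
Qed.

Let sumhE p q : \sum_b h p (q, b) =
  (pc n (absz (p.1.+1%:Z - q.1.+1%:Z)) + pc n (absz (p.1.+1%:Z + q.1.+1%:Z))) *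
  (pc n (absz (p.2.+1%:Z - q.2.+1%:Z)) + pc n (absz (p.2.+1%:Z + q.2.+1%:Z))).
Proof.
rewrite -(pair_big xpredT xpredT (fun b1 b2 => h p (q, (b1, b2)))) /=.
by rewrite !big_bool /h /sgn /=; ring.
Qed.

Let V_off p q : q != p -> `|V p q| <= \sum_b h p (q, b).
Proof.
move=> qp; rewrite /V eq_sym (negbTE qp) mulr0 subr0 sumhE normrM.
by apply: ler_pM => //; exact: normA.
Qed.

Let V_diag p : pc n 0 ^+ 2 - e - \sum_(b | (p, b) != (p, (false, false))) h p (p, b) <= V
    p p.
Proof.
pose T i := pc n (absz (i%:Z + i%:Z)).
pose s t (i : nat) := T i * cos ((i%:Z + i%:Z)%:~R * t).
have AE t i : A t i i = pc n 0 - s t i.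
  by rewrite /A /s /T subrr mul0r cos0 mulr1.
have /ler_normlP[s11 s12] : `|s x0 p.1.+1| <= T p.1.+1 by exact: pc_cos_le.
have /ler_normlP[s21 s22] : `|s y0 p.2.+1| <= T p.2.+1 by exact: pc_cos_le.
have H : pc n 0 ^+ 2 +
    \sum_(b | (p, b) != (p, (false, false))) h p (p, b) =
    (pc n 0 + T p.1.+1) * (pc n 0 + T p.2.+1).
  have := sumhE p p; rewrite (bigD1 (false, false)) //=.
  rewrite (eq_bigl (fun b => (p, b) != (p, (false, false)))); last first.
    by move=> b; rewrite xpair_eqE eqxx.
  by rewrite [h p (p, (false, false))]/h /= !subrr expr2.
rewrite /V eqxx mulr1 !AE; move: H s11 s12 s21 s22.
move: (s _ _) (s _ _) (T _) (T _) (\sum_(b | _) _) => s1 s2 t1 t2 Sb H s11 s12 s21 s22.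
have c0 : 0 <= pc n 0 := pc_ge0 n 0.
have h1 : pc n 0 * s1 <= pc n 0 * t1 by rewrite ler_wpM2l; lra.
have h2 : pc n 0 * s2 <= pc n 0 * t2 by rewrite ler_wpM2l; lra.
have h3 : - (t1 * t2) <= s1 * s2.
  have /ler_normlP[] : `|s1 * s2| <= t1 * t2.
    by rewrite normrM; apply: ler_pM => //; rewrite ler_norml; apply/andP; split; lra.
  by lra.
nra.
Qed.

Let sgn_inj b b' i j : sgn b i.+1 = sgn b' j.+1 -> b = b' /\ i = j.
Proof. by rewrite /sgn; case: b; case: b' => /= H; split => //; lia. Qed.

Let sgn_sqr b j : sgn b j ^+ 2 = j%:Z ^+ 2.
Proof. by rewrite /sgn; case: b; rewrite ?sqrrN. Qed.

(** All the reflected points lie on the same circle, hence at most one of them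
    other than [p] itself is within distance [n] of [p]; its contribution is at
    most [pc n 0 * pc n 1], since one of the two differences is nonzero. *)
Let offdiag_sum p : S p ->
  \sum_(x | S x.1 && (x != (p, (false, false)))) h p x <= pc n 0 * pc n 1.
Proof.
move=> Sp; apply: sum_at_most_one.
- by rewrite mulr_ge0// pc_ge0.
- move=> [[i j] [b1 b2]] /andP[_ ne]; rewrite h_ge0 /= /h /=.
  have : (1 <= absz (p.1.+1%:Z - sgn b1 i.+1))%N \/ (1 <= absz (p.2.+1%:Z - sgn b2 j.+1))%N.
    rewrite !absz_gt0 !subr_eq0; apply/orP; apply: contraNT ne.
    rewrite negb_or !negbK => /andP[/eqP h1 /eqP h2].
    have [<- e1] := @sgn_inj false b1 _ _ h1; have [<- e2] := @sgn_inj false b2 _ _ h2.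
    case: p {Sp h1 h2} e1 e2 => pi pj /= e1 e2.
    by rewrite !xpair_eqE !eqxx !andbT; apply/andP; split; apply/eqP/val_inj.
  case=> H; last by apply: ler_pM; rewrite ?pc_ge0 ?pc_decr.
  by rewrite mulrC; apply: ler_pM; rewrite ?pc_ge0 ?pc_decr.
- have hn (x : I * (bool * bool)) : h p x != 0 ->
    `|sgn x.2.1 x.1.1.+1 - p.1.+1%:Z| <= n%:Z /\ `|sgn x.2.2 x.1.2.+1 - p.2.+1%:Z| <= n%:Z.
    rewrite /h mulf_eq0 negb_or => /andP[h1 h2].
    split; rewrite distrC.
      by rewrite leNgt; apply: contraNN h1 => H; rewrite pc_large//; lia.
    by rewrite leNgt; apply: contraNN h2 => H; rewrite pc_large//; lia.
  have vn0 (x : I * (bool * bool)) : x != (p, (false, false)) ->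
    (sgn x.2.1 x.1.1.+1 - p.1.+1%:Z != 0) || (sgn x.2.2 x.1.2.+1 - p.2.+1%:Z != 0).
    case: x => [[i j] [b1 b2]] /= ne; rewrite !subr_eq0; apply: contraNT ne.
    rewrite negb_or !negbK => /andP[/eqP h1 /eqP h2].
    have [-> e1] := @sgn_inj b1 false _ _ h1; have [-> e2] := @sgn_inj b2 false _ _ h2.
    case: p {Sp hn h1 h2} e1 e2 => pi pj /= e1 e2.
    by rewrite !xpair_eqE !eqxx !andbT; apply/andP; split; apply/eqP/val_inj.
  have on (x : I * (bool * bool)) : S x.1 ->
     (p.1.+1%:Z + (sgn x.2.1 x.1.1.+1 - p.1.+1%:Z)) ^+ 2 +
     (p.2.+1%:Z + (sgn x.2.2 x.1.2.+1 - p.2.+1%:Z)) ^+ 2 = L%:Z.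
    rewrite /S => /eqP <-; rewrite !subrKC !sgn_sqr.
    by rewrite PoszD !PoszX.
  have onp : p.1.+1%:Z ^+ 2 + p.2.+1%:Z ^+ 2 = L%:Z.
    by move: Sp; rewrite /S => /eqP <-; rewrite PoszD !PoszX.
  have HLz : 8 * n%:Z ^+ 6 < L%:Z by rewrite -PoszX (_ : 8 = 8%N%:Z)// -PoszM ltz_nat.
  move=> x y /andP[Sx nx] /andP[Sy ny] hx hy.
  have [lx1 lx2] := hn _ hx; have [ly1 ly2] := hn _ hy.
  have [] := circle_close_eq _ _ _ _ _ _ _ _ onp (on _ Sx) (on _ Sy) lx1 lx2 ly1 ly2
    (vn0 _ nx) (vn0 _ ny) HLz.
  move=> /addIr/sgn_inj[e1 e2] /addIr/sgn_inj[e3 e4].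
  case: x y e1 e2 e3 e4 {Sx Sy nx ny hx hy lx1 lx2 ly1 ly2}.
  move=> [i j] [b1 b2] [[i' j'] [b1' b2']] /= -> e2 -> e4.
  by congr ((_, _), _); apply: val_inj.
Qed.

Lemma kernel_row_dominant p : S p ->
  pc n 0 ^+ 2 - pc n 0 * pc n 1 - e <= V p p - \sum_(q | S q && (q != p)) `|V p q|.
Proof.
move=> Sp; have H1 := offdiag_sum _ Sp; have H2 := V_diag p.
have H3 : \sum_(q | S q && (q != p)) `|V p q| <=
          \sum_(q | S q && (q != p)) \sum_b h p (q, b).
  by apply: ler_sum => q /andP[_ qp]; exact: V_off.
have H4 : \sum_(x | S x.1 && (x != (p, (false, false)))) h p x =
   \sum_(b | (p, b) != (p, (false, false))) h p (p, b) +
   \sum_(q | S q && (q != p)) \sum_b h p (q, b).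
  rewrite (eq_bigr (fun x => h p (x.1, x.2))); last by case.
  rewrite (eq_bigl (fun x : I * (bool * bool) => S x.1 && ((x.1, x.2) != (p, (false,
      false))))); last by case.
  rewrite -(pair_big_dep S (fun q b => (q, b) != (p, (false, false))) (fun q b => h p (q,
      b))) /=.
  rewrite (bigD1 p) //=; congr (_ + _); apply: eq_bigr => q /andP[_ qp].
  by apply: eq_bigl => b; rewrite xpair_eqE (negbTE qp).
lra.
Qed.

Lemma kernel_form_lower (a : I -> R) :
  (pc n 0 ^+ 2 - pc n 0 * pc n 1 - e) * \sum_(p | S p) a p ^+ 2 <=
  \sum_(p | S p) \sum_(q | S q) a p * a q * V p q.
Proof. exact: (diag_dominant_lower _ _ _ _ V_sym kernel_row_dominant). Qed.

End row_sums.

Lemma peak_ge0 n (t : R) : 0 <= peak n t.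
Proof. by rewrite /peak exprn_ge0// divr_ge0//; have := cos_geN1 t; lra. Qed.

Lemma peak_le1 n (t : R) : peak n t <= 1.
Proof.
by rewrite /peak exprn_ile1//; have := cos_geN1 t; have := cos_le1 t; lra.
Qed.

Lemma peak_le n (s t : R) : cos s <= cos t -> peak n s <= peak n t.
Proof.
by move=> st; rewrite /peak lerXn2r ?nnegrE//; have := cos_geN1 t; have := cos_geN1 s; lra.
Qed.

Lemma kern_ge0 n (x0 x : R) : 0 <= kern n x0 x.
Proof. by rewrite /kern divr_ge0// addr_ge0// peak_ge0. Qed.

Lemma kern_le1 n (x0 x : R) : kern n x0 x <= 1.
Proof.
by rewrite /kern; have := peak_le1 n (x - x0); have := peak_le1 n (x + x0); lra.
Qed.

Lemma kern_ge_half n (x0 x : R) : peak n (x - x0) / 2 <= kern n x0 x.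
Proof. by rewrite /kern; have := peak_ge0 n (x + x0); lra. Qed.

Lemma kern_le_peak n (x0 x : R) : 0 <= x0 <= pi -> 0 <= x <= pi ->
  kern n x0 x <= peak n (x - x0).
Proof.
move=> hx0 hx; have : peak n (x + x0) <= peak n (x - x0).
  apply: peak_le; rewrite cosB cosD.
  have : 0 <= sin x * sin x0 by rewrite mulr_ge0// sin_ge0_pi.
  by lra.
by rewrite /kern; lra.
Qed.

Lemma cos_far (x0 x d : R) : 0 <= x0 <= pi -> 0 <= x <= pi -> 0 <= d ->
  d <= `|x - x0| -> cos (x - x0) <= cos d.
Proof.
move=> /andP[a1 a2] /andP[b1 b2] d0 dx; rewrite -(cos_norm (x - x0)).
have xpi : `|x - x0| <= pi by rewrite ler_norml; apply/andP; split; lra.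
by rewrite leNgt ltr_cos -?leNgt// in_itv /=; apply/andP; split => //; lra.
Qed.

Lemma kern_far n (x0 x d : R) : 0 <= x0 <= pi -> 0 <= x <= pi -> 0 <= d ->
  d <= `|x - x0| -> kern n x0 x <= peak n d.
Proof.
move=> h0 h d0 dx; apply: le_trans (kern_le_peak n _ _ h0 h) _.
by apply: peak_le; exact: cos_far.
Qed.

Lemma kern2_far n (x0 y0 d : R) (z : R * R) :
  0 <= x0 <= pi -> 0 <= y0 <= pi -> 0 <= d ->
  box 0 pi 0 pi z -> ~ box (x0 - d) (x0 + d) (y0 - d) (y0 + d) z ->
  kern n x0 z.1 * kern n y0 z.2 <= peak n d.
Proof.
case: z => x y hx0 hy0 d0 []; rewrite /= !in_itv /= => hx hy nB.
have [dx|dx] := leP d `|x - x0|.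
  rewrite -[X in _ <= X]mulr1; apply: ler_pM; rewrite ?kern_ge0 ?kern_le1//.
  exact: kern_far.
have [dy|dy] := leP d `|y - y0|.
  rewrite -[X in _ <= X]mul1r; apply: ler_pM; rewrite ?kern_ge0 ?kern_le1//.
  exact: kern_far.
exfalso; apply: nB; split; rewrite /= in_itv /=.
  by move: dx; rewrite ltr_norml => /andP[? ?]; apply/andP; split; lra.
by move: dy; rewrite ltr_norml => /andP[? ?]; apply/andP; split; lra.
Qed.

(** The degree [n] of the kernels is chosen by [exists_gap], which fixes the
    margin [c] of diagonal dominance; only then is the threshold on the
    frequencies, of order [n ^ 6], determined.  The constant does not depend on
    the number of modes. *)
Lemma high_frequency_lower (x0 y0 d : R) :
  0 < d -> 0 <= x0 - d -> x0 + d <= pi -> 0 <= y0 - d -> y0 + d <= pi ->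
  exists2 c : R, 0 < c & exists Lam : nat, forall N (a : 'I_N * 'I_N -> R) (L : nat),
    (Lam < L)%N ->
    (forall p, a p != 0 -> (p.1.+1 ^ 2 + p.2.+1 ^ 2)%N = L) ->
    c * \int[area R]_(z in box 0 pi 0 pi) (sine_sum a z ^+ 2) <=
    \int[area R]_(z in box (x0 - d) (x0 + d) (y0 - d) (y0 + d)) (sine_sum a z ^+ 2).
Proof.
move=> d0 hx1 hx2 hy1 hy2.
have x0I : 0 <= x0 <= pi by apply/andP; split; lra.
have y0I : 0 <= y0 <= pi by apply/andP; split; lra.
pose r : R := (1 + cos d) / 2.
have r01 : 0 <= r < 1.
  have : cos d < 1.
    rewrite -[X in _ < X]cos0 ltr_cos ?in_itv /=; [by []|..];
      by apply/andP; split; lra.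
  by have := cos_geN1 d; rewrite /r => ? ?; apply/andP; split; lra.
have [n c0] := exists_gap _ r01.
set c := (X in 0 < X) in c0.
exists c => //; exists (8 * n ^ 6)%N => N a L HL Ha.
set B := box (x0 - d) _ _ _.
have cu : continuous (sine_sum a) by exact: cont_sine_sum.
have ck t : continuous (@kern R n t) by exact: kern_cont.
pose e := r ^+ n.
pose W (z : R * R) := (kern n x0 z.1 * kern n y0 z.2 - e) * sine_sum a z ^+ 2.
have cK1 : continuous (fun z : R * R => kern n x0 z.1) by apply: cont_fst.
have cK2 : continuous (fun z : R * R => kern n y0 z.2) by apply: cont_snd.
have cW : continuous W by rewrite /W; cont.
apply: (@le_trans _ _ (\int[area R]_(z in box 0 pi 0 pi) W z)); last first.
  apply: (@le_trans _ _ (\int[area R]_(z in B) W z)); last first.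
    apply: box_int_le => //; first by cont.
    move=> z _; rewrite /W ler_piMl ?sqr_ge0//.
    have : kern n x0 z.1 * kern n y0 z.2 <= 1.
      by rewrite mulr_ile1 ?kern_ge0 ?kern_le1.
    have : 0 <= e by rewrite exprn_ge0//; case/andP: r01.
    by lra.
  have := @Rintegral_le_subset _ _ _ (area R) B (box 0 pi 0 pi) (fun z => - W z).
  move=> /(_ (measurable_box _ _ _ _) (measurable_box _ _ _ _)).
  have -> : \int[area R]_(x in B) (- W x) = - \int[area R]_(x in B) W x.
    rewrite -mulN1r -box_intZ//; apply: eq_Rintegral => z _; by rewrite mulN1r.
  have -> : \int[area R]_(x in box 0 pi 0 pi) (- W x) = - \int[area R]_(x in box 0 pi 0
      pi) W x.
    rewrite -mulN1r -box_intZ//; apply: eq_Rintegral => z _; by rewrite mulN1r.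
  rewrite lerN2; apply.
  - by apply: box_integrable; cont.
  - by apply: subset_box; lra.
  - move=> z Mz nBz; rewrite oppr_ge0 mulr_le0_ge0 ?sqr_ge0// subr_le0.
    exact: (kern2_far _ _ _ _ _ x0I y0I (ltW d0)).
have -> : \int[area R]_(z in box 0 pi 0 pi) W z =
  \int[area R]_(z in box 0 pi 0 pi) (kern n x0 z.1 * kern n y0 z.2 * sine_sum a z ^+ 2) +
  - e * \int[area R]_(z in box 0 pi 0 pi) (sine_sum a z ^+ 2).
  rewrite -box_intZ; last by cont.
  rewrite -box_intD; [|by cont|by cont].
  by apply: eq_Rintegral => z _; rewrite /W mulrBl mulNr.
rewrite box_int_sine_sum//.
rewrite sine_sum_parseval.
have := @kernel_form_lower n N L x0 y0 e HL a.
have suppE (F : 'I_N * 'I_N -> R) : (forall p, a p = 0 -> F p = 0) ->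
    \sum_(p : 'I_N * 'I_N | (p.1.+1 ^ 2 + p.2.+1 ^ 2 == L)%N) F p = \sum_p F p.
  move=> F0; rewrite big_mkcond; apply: eq_bigr => p _; case: ifPn => // np.
  rewrite F0//; apply/eqP; apply: contraNT np => /Ha ->; exact: eqxx.
rewrite suppE; last by move=> p ->; rewrite expr0n.
rewrite suppE; last by move=> p ->; rewrite big1// => q _; rewrite !mul0r.
move=> H.
have pi20 : 0 < (pi / 2 : R) ^+ 2 by rewrite exprn_gt0// divr_gt0// pi_gt0.
rewrite -(ler_pM2l pi20) in H.
rewrite mulrCA; apply: le_trans H _; rewrite le_eqVlt; apply/orP; left; apply/eqP.
rewrite mulrCA !mulr_sumr -big_split; apply: eq_bigr => p _ /=.
rewrite suppE; last by move=> q ->; rewrite mulr0 mul0r.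
rewrite [in RHS](bigD1 p) //= [in LHS](bigD1 p) //= mulrDr addrAC; congr (_ + _).
  by rewrite !int_kern_sin eqxx mulr1 /=; ring.
rewrite mulr_sumr; apply: eq_bigr => q qp.
by rewrite !int_kern_sin eq_sym (negbTE qp) mulr0 /=; ring.
Qed.

End sine_sums.

(** * Sine sums at low frequency *)

Section gram.
Context {R : realFieldType} {N : nat}.
Implicit Types (G : 'I_N -> 'I_N -> R) (b : 'I_N -> R).

(** With [M] the matrix of the form, [v] the vector of [b] and
    [w = v M^-1], positivity of the form at [v - w / K] reads
    [0 <= Q v - 2 |v| ^ 2 / K + Q w / K ^ 2], and [Q w = v M^-1 v^T] is at most
    [K |v| ^ 2] when [K] exceeds the sum of the entries of [M^-1] in absolute
    value; hence [Q v >= |v| ^ 2 / K]. *)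
Lemma posdef_lower G : (forall i j, G i j = G j i) ->
  (forall b, (exists i, b i != 0) -> 0 < \sum_i \sum_j b i * b j * G i j) ->
  exists2 c : R, 0 < c & forall b,
    c * \sum_i b i ^+ 2 <= \sum_i \sum_j b i * b j * G i j.
Proof.
move=> symG posG.
pose Q b := \sum_i \sum_j b i * b j * G i j.
have Q_ge0 b : 0 <= Q b.
  have [/existsP ex|/existsPn all0] := boolP [exists i, b i != 0].
    by apply: ltW; exact: posG.
  rewrite /Q big1// => i _; rewrite big1// => j _.
  by have := all0 i; rewrite negbK => /eqP ->; rewrite !mul0r.
pose M : 'M[R]_N := \matrix_(i, j) G i j.
have QE (v : 'rV[R]_N) : Q (v 0) = (v *m M *m v^T) 0 0.
  rewrite mxE /Q exchange_big /=; apply: eq_bigr => j _.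
  rewrite !mxE mulr_suml; apply: eq_bigr => i _; rewrite !mxE; ring.
have Munit : M \in unitmx.
  rewrite -row_free_unit; apply: inj_row_free => v vM.
  apply/rowP => i; rewrite mxE; apply/eqP; apply: contraTT isT => vi.
  have : 0 < Q (v 0) by apply: posG; exists i.
  by rewrite QE vM mul0mx mxE ltxx.
pose K := 1 + \sum_i \sum_j `|invmx M i j|.
have K0 : 0 < K.
  rewrite ltr_pwDl// sumr_ge0// => i _; apply: sumr_ge0 => j _; exact: normr_ge0.
exists K^-1; first by rewrite invr_gt0.
move=> b; rewrite -/(Q b).
pose v : 'rV[R]_N := \row_i b i.
have bE i : b i = v 0 i by rewrite mxE.
have [w wE] : exists w, w = (invmx M *m v^T)^T by eexists.
pose n2 := \sum_i b i ^+ 2.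
have n2_ge0 : 0 <= n2 by rewrite sumr_ge0// => i _; exact: sqr_ge0.
have n2E : (v *m v^T) 0 0 = n2.
  by rewrite mxE; apply: eq_bigr => i _; rewrite !mxE expr2.
have symM : M^T = M by apply/matrixP => i j; rewrite !mxE symG.
have vMw : v *m M *m w^T = v *m v^T.
  by rewrite wE trmxK -mulmxA mulKVmx.
have wMv : w *m M *m v^T = v *m v^T.
  by apply: trmx_inj; rewrite !trmx_mul !trmxK symM mulmxA vMw.
have wMw : (w *m M *m w^T) 0 0 <= K * n2.
  have -> : w *m M *m w^T = v *m invmx M *m v^T.
    by rewrite wE trmxK -mulmxA mulKVmx// trmx_mul trmxK trmx_inv symM.
  rewrite mxE.
  apply: (@le_trans _ _ (\sum_j \sum_i `|invmx M i j| * n2)); last first.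
    under eq_bigr do rewrite -mulr_suml.
    by rewrite -mulr_suml ler_wpM2r// /K exchange_big /= lerDr.
  apply: ler_sum => j _; rewrite !mxE mulr_suml; apply: ler_sum => i _.
  rewrite !mxE mulrAC mulrC.
  have h : `|b i * b j| <= n2.
    have h1 (k : 'I_N) : b k ^+ 2 <= n2.
      by rewrite /n2 (bigD1 k) //= lerDl sumr_ge0// => ? _; exact: sqr_ge0.
    have := h1 i; have := h1 j; rewrite normrM.
    rewrite -(real_normK (num_real (b i))) -(real_normK (num_real (b j))).
    have := sqr_ge0 (`|b i| - `|b j|); rewrite sqrrB; lra.
  apply: le_trans (ler_norm _) _; rewrite normrM.
  by rewrite ler_wpM2l.
have := Q_ge0 ((v - K^-1 *: w) 0); rewrite QE.
have -> : (v - K^-1 *: w) *m M *m (v - K^-1 *: w)^T =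
   v *m M *m v^T - (K^-1 * 2) *: (v *m v^T) + (K^-1 * K^-1) *: (w *m M *m w^T).
  have tB : (v - K^-1 *: w)^T = v^T - K^-1 *: w^T.
    by apply/matrixP => i j; rewrite !mxE.
  rewrite tB !mulmxBr !mulmxBl -!scalemxAl -!scalemxAr.
  rewrite vMw wMv scalerA.
  set X := v *m M *m _; set Y := v *m v^T; set Z := w *m M *m _.
  by rewrite mulr_natr mulr2n scalerDl !opprD opprK !addrA.
have E (X Y Z : 'M[R]_1) (r t : R) :
    (X - r *: Y + t *: Z) 0 0 = X 0 0 - r * Y 0 0 + t * Z 0 0 by rewrite !mxE.
rewrite E -QE n2E.
have -> : Q (v 0) = Q b.
  by rewrite /Q; apply: eq_bigr => i _; apply: eq_bigr => j _; rewrite !mxE.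
move: wMw; set WW := (w *m M *m w^T) 0 0 => hW.
have K1 : 0 < K^-1 by rewrite invr_gt0.
have : K^-1 * K^-1 * WW <= K^-1 * n2.
  rewrite -mulrA ler_pM2l// -(ler_pM2l K0) mulrA divff ?mul1r// gt_eqF//.
rewrite -/n2; lra.
Qed.

End gram.

Section independence.
Context {R : realType}.
Local Notation mu := (@lebesgue_measure R).

(** The operator sending [f] to [f (x + s) + f (x - s) - 2 cos (N s) f x] is
    diagonal on the functions [sin (i x)], with eigenvalues
    [2 (cos (i s) - cos (N s))].  It kills the mode [N], only shrinks the
    interval by [s] at both ends, and is injective on the lower modes when
    [N s < pi]. *)
Lemma sin_indep N (b : nat -> R) (al be : R) : al < be ->
  (forall x, al < x < be -> \sum_(i < N) b i * sin (i.+1%:R * x) = 0) ->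
  forall i, (i < N)%N -> b i = 0.
Proof.
elim: N b al be => [//|N IH] b al be ab H.
(* a step small enough for the multiples of it to stay in [0, pi] *)
pose s := Num.min ((be - al) / 3) (pi / N.+2%:R).
have s0 : 0 < s by rewrite lt_min !divr_gt0 ?pi_gt0 ?subr_gt0.
have s1 : s <= (be - al) / 3 by rewrite ge_min lexx.
have s2 : N.+1%:R * s < pi.
  have h : s <= pi / N.+2%:R by rewrite ge_min lexx orbT.
  have h2 : N.+2%:R * s <= pi by move: h; rewrite ler_pdivlMr// mulrC.
  by apply: lt_le_trans h2; rewrite ltr_pM2r// ltr_nat.
have cI (k : nat) : (k <= N.+1)%N -> k%:R * s \in `[0, pi].
  move=> kN; rewrite in_itv /=; apply/andP; split; first by rewrite mulr_ge0// ltW.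
  by apply/ltW; apply: le_lt_trans s2; rewrite ler_pM2r// ler_nat.
pose c i := 2 * b i * (cos (i.+1%:R * s) - cos (N.+1%:R * s)).
have Hc i : (i < N)%N -> c i = 0.
  apply: (IH c (al + s) (be - s)); first by lra.
  move=> x /andP[x1 x2].
  have e1 : \sum_(i < N.+1) b i * sin (i.+1%:R * (x + s)) = 0 by apply: H; apply/andP;
      split; lra.
  have e2 : \sum_(i < N.+1) b i * sin (i.+1%:R * (x - s)) = 0 by apply: H; apply/andP;
      split; lra.
  have e3 : \sum_(i < N.+1) b i * sin (i.+1%:R * x) = 0 by apply: H; apply/andP; split; lra.
  have : \sum_(i < N.+1) c i * sin (i.+1%:R * x) = 0.
    transitivity (\sum_(i < N.+1) b i * sin (i.+1%:R * (x + s)) +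
       \sum_(i < N.+1) b i * sin (i.+1%:R * (x - s)) -
       2 * cos (N.+1%:R * s) * \sum_(i < N.+1) b i * sin (i.+1%:R * x)); last first.
      by rewrite e1 e2 e3 mulr0 subr0 addr0.
    rewrite mulr_sumr -big_split -sumrB; apply: eq_bigr => j _ /=.
    by rewrite mulrDr mulrBr sinD sinB /c; ring.
  have cN : c N = 0 by rewrite /c subrr mulr0.
  by rewrite big_ord_recr /= cN mul0r addr0.
have Hb i : (i < N)%N -> b i = 0.
  move=> iN; have := Hc i iN; rewrite /c => /eqP; rewrite !mulf_eq0 pnatr_eq0 /=.
  case/orP => [/eqP//|]; rewrite subr_eq0 => /eqP /cos_inj h.
  have := h (cI _ _) (cI _ _); move=> /(_ (ltnW _) (leqnn _)).
  have -> : (i.+1%:R * s = N.+1%:R * s) <-> False.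
    split=> // /(mulIf (lt0r_neq0 s0)) /eqP; rewrite eqr_nat eqSS => /eqP E.
    by rewrite E ltnn in iN.
  by move=> /(_ iN).
have top x : al < x < be -> b N * sin (N.+1%:R * x) = 0.
  move=> /H; rewrite big_ord_recr /= big1 ?add0r// => i _.
  by rewrite Hb// mul0r.
have bN : b N = 0.
  apply/eqP; apply: contraTT isT => bN.
  have S x : al < x < be -> sin (N.+1%:R * x) = 0.
    by move=> /top/eqP; rewrite mulf_eq0 (negbTE bN) => /eqP.
  have h1 : sin (N.+1%:R * (al + s)) = 0 by apply: S; apply/andP; split; lra.
  have h2 : sin (N.+1%:R * (al + s + s)) = 0 by apply: S; apply/andP; split; lra.
  move: h2; rewrite (mulrDr _ (al + s)) sinD h1 mul0r add0r => /eqP.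
  have ss : 0 < sin (N.+1%:R * s) by apply: sin_gt0_pi; rewrite mulr_gt0.
  rewrite mulf_eq0 (gt_eqF ss) orbF => /eqP h3.
  have := sin0cos1 h1; rewrite h3 normr0 => /eqP.
  by rewrite eq_sym oner_eq0.
move=> i; rewrite ltnS leq_eqVlt => /orP[/eqP->//|]; exact: Hb.
Qed.

Lemma seg_int_eq0 (f : R -> R) (al be x : R) : continuous f ->
  (forall y, al <= y <= be -> 0 <= f y) ->
  \int[mu]_(y in `[al, be]) f y = 0 -> al < x < be -> f x = 0.
Proof.
move=> cf f0 If /andP[alx xbe].
have fx0 : 0 <= f x by apply: f0; rewrite !ltW.
apply/eqP; rewrite eq_le fx0 andbT leNgt; apply/negP => fx.
have [e /= e0 He] : exists2 e : R, 0 < e & forall y, `|x - y| < e -> f x / 2 <= f y.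
  have /cvgrPdist_lt/(_ (f x / 2)) := cf x; rewrite divr_gt0// => /(_ isT).
  move=> /nbhs_ballP[e /= e0 He]; exists e => // y xy.
  have := He y xy; rewrite /= ltr_norml => /andP[_]; lra.
pose r := Num.min (e / 2) (Num.min (x - al) (be - x)).
have r0 : 0 < r by rewrite !lt_min divr_gt0// !subr_gt0 alx.
have r1 : r <= e / 2 by rewrite ge_min lexx.
have r2 : r <= x - al by rewrite !ge_min lexx orbT.
have r3 : r <= be - x by rewrite !ge_min lexx !orbT.
clearbody r.
have : \int[mu]_(y in `[x - r, x + r]) f y <= 0.
  rewrite -[X in _ <= X]If; apply: Rintegral_le_subset.
  - exact: measurable_itv.
  - exact: measurable_itv.
  - exact: segment_integrable.
  - by move=> y; rewrite /= !in_itv /= => /andP[? ?]; apply/andP; split; lra.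
  - by move=> y; rewrite /= in_itv /= => /f0.
apply/negP; rewrite -ltNge.
apply: (@lt_le_trans _ _ (\int[mu]_(y in `[x - r, x + r]) (f x / 2))).
  by rewrite seg_int_cst ?mulr_gt0//; lra.
apply: seg_int_le => //; first by cont.
move=> y /andP[? ?]; apply: He; rewrite ltr_norml; apply/andP; split; lra.
Qed.

Lemma sin_form_lower N (al be : R) : al < be ->
  exists2 c : R, 0 < c & forall b : 'I_N -> R,
    c * \sum_i b i ^+ 2 <= \sum_i \sum_j b i * b j *
      \int[mu]_(x in `[al, be]) (sin (i.+1%:R * x) * sin (j.+1%:R * x)).
Proof.
move=> ab; apply: posdef_lower => [i j|b [k bk]].
  by apply: eq_Rintegral => x _; rewrite mulrC.
pose f x := \sum_(i < N) b i * sin (i.+1%:R * x).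
have cf : continuous f by rewrite /f; cont.
have -> : \sum_i \sum_j b i * b j *
    \int[mu]_(x in `[al, be]) (sin (i.+1%:R * x) * sin (j.+1%:R * x)) =
    \int[mu]_(x in `[al, be]) (f x ^+ 2).
  transitivity (\int[mu]_(x in `[al, be]) \sum_i \sum_j b i * b j * (sin (i.+1%:R * x) *
      sin (j.+1%:R * x))).
    rewrite seg_int_sum; last by cont.
    apply: eq_bigr => i _; rewrite seg_int_sum; last by cont.
    by apply: eq_bigr => j _; rewrite seg_intZ//; cont.
  apply: eq_Rintegral => x _; rewrite expr2 /f mulr_suml.
  apply: eq_bigr => i _; rewrite mulr_sumr; apply: eq_bigr => j _; ring.
rewrite lt_def Rintegral_ge0 ?andbT; last by move=> x _; exact: sqr_ge0.
apply: contraNN bk => /eqP I0.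
pose b' (i : nat) := if insub i is Some i' then b i' else 0.
have b'E (i : 'I_N) : b' i = b i by rewrite /b' valK.
rewrite -b'E; apply/eqP; apply: (sin_indep N b' al be) => // x xab.
apply/eqP; rewrite -sqrf_eq0; apply/eqP.
under eq_bigr do rewrite b'E.
apply: (seg_int_eq0 (fun x => f x ^+ 2) al be) => //; first by cont.
by move=> y _; exact: sqr_ge0.
Qed.

(** The sum is expanded first in [y], with coefficients [A k x] that are sine
    sums in [x], so that the one-dimensional bound applies twice. *)
Lemma low_frequency_lower N (x1 x2 y1 y2 : R) : x1 < x2 -> y1 < y2 ->
  exists2 c : R, 0 < c & forall a : 'I_N * 'I_N -> R,
    c * \int[area R]_(z in box 0 pi 0 pi) (sine_sum a z ^+ 2) <=
    \int[area R]_(z in box x1 x2 y1 y2) (sine_sum a z ^+ 2).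
Proof.
move=> x12 y12.
have [c1 c10 H1] := sin_form_lower N x1 x2 x12.
have [c2 c20 H2] := sin_form_lower N y1 y2 y12.
have pi20 : 0 < (pi / 2 : R) ^+ 2 by rewrite exprn_gt0// divr_gt0// pi_gt0.
exists (c1 * c2 / (pi / 2) ^+ 2); first by rewrite divr_gt0// mulr_gt0.
move=> a; rewrite sine_sum_parseval mulrA divfK ?gt_eqF//.
have cu : continuous (fun z => sine_sum a z ^+ 2).
  by apply: contX; exact: cont_sine_sum.
pose A (k : 'I_N) x := \sum_(j < N) a (j, k) * sin (j.+1%:R * x).
have cA k : continuous (A k) by rewrite /A; cont.
have uE x y : sine_sum a (x, y) = \sum_k A k x * sin (k.+1%:R * y).
  rewrite /sine_sum.
  rewrite (eq_bigr (fun p => a (p.1, p.2) * sine_mode p.1 p.2 (x, y))); last by case.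
  rewrite -(pair_big xpredT xpredT (fun j k : 'I_N => a (j, k) * sine_mode j k (x, y))) /=.
  rewrite exchange_big /=; apply: eq_bigr => k _; rewrite mulr_suml.
  by apply: eq_bigr => j _; rewrite /sine_mode /=; ring.
pose g i j := \int[mu]_(y in `[y1, y2]) (sin (i.+1%:R * y) * sin (j.+1%:R * y)).
have -> : \int[area R]_(z in box x1 x2 y1 y2) (sine_sum a z ^+ 2) =
    \int[mu]_(x in `[x1, x2]) \sum_i \sum_j A i x * A j x * g i j.
  rewrite box_fubini12//; apply: eq_Rintegral => x _.
  transitivity (\int[mu]_(y in `[y1, y2]) \sum_i \sum_j A i x * A j x * (sin (i.+1%:R *
      y) * sin (j.+1%:R * y))).
    apply: eq_Rintegral => y _; rewrite uE expr2 mulr_suml.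
    apply: eq_bigr => i _; rewrite mulr_sumr; apply: eq_bigr => j _; ring.
  rewrite seg_int_sum; last by cont.
  apply: eq_bigr => i _; rewrite seg_int_sum; last by cont.
  by apply: eq_bigr => j _; rewrite seg_intZ//; cont.
apply: (@le_trans _ _ (\int[mu]_(x in `[x1, x2]) (c2 * \sum_k A k x ^+ 2))); last first.
  by apply: seg_int_le => [||x _]; [cont|cont|exact: H2].
rewrite seg_intZ; last by cont.
rewrite seg_int_sum; last by cont.
rewrite (mulrC c1) -mulrA ler_pM2l//.
have -> : \sum_p a p ^+ 2 = \sum_k \sum_j a (j, k) ^+ 2.
  rewrite exchange_big /= (pair_big xpredT xpredT (fun j k : 'I_N => a (j, k) ^+ 2)) /=.
  by apply: eq_bigr; case.
rewrite mulr_sumr; apply: ler_sum => k _.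
apply: le_trans (H1 (fun j => a (j, k))) _.
rewrite le_eqVlt; apply/orP; left; apply/eqP.
transitivity (\int[mu]_(x in `[x1, x2]) \sum_i \sum_j a (i, k) * a (j, k) * (sin (i.+1%:R
    * x) * sin (j.+1%:R * x))).
  rewrite seg_int_sum; last by cont.
  apply: eq_bigr => i _; rewrite seg_int_sum; last by cont.
  by apply: eq_bigr => j _; rewrite seg_intZ//; cont.
apply: eq_Rintegral => x _; rewrite expr2 /A mulr_suml.
by apply: eq_bigr => i _; rewrite mulr_sumr; apply: eq_bigr => j _; ring.
Qed.

End independence.

(** * Completeness of the sines on the square *)

Section completeness.
Context {R : realType}.
Local Notation M := (box (0:R) pi 0 pi).

(** [kern] is a sum of cosines, and [sin u * cos (m u)] is the half-sum of
    [sin ((1 + m) u)] and [sin ((1 - m) u)]. *)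
Lemma kern_orthogonal (w p : R * R -> R) (n : nat) (t : R) :
  continuous w -> continuous p ->
  (forall l : int, \int[area R]_(z in M) (w z * sin (l%:~R * p z)) = 0) ->
  \int[area R]_(z in M) (w z * (sin (p z) * kern n t (p z))) = 0.
Proof.
move=> cw cp H.
pose c (i : nat) : R := (4 ^+ n)^-1 * ('C(n.*2, i)%:R * cos ((i%:Z - n%:Z)%:~R * t)) / 2.
transitivity (\int[area R]_(z in M) \sum_(i < n.*2.+1)
   c i * (w z * sin ((1 + (i%:Z - n%:Z))%:~R * p z) + w z * sin ((1 - (i%:Z - n%:Z))%:~R
       * p z))).
  apply: eq_Rintegral => z _; rewrite kern_fourier mulr_sumr mulr_sumr mulr_sumr.
  apply: eq_bigr => i _; rewrite /c; set m := (i%:Z - n%:Z).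
  have -> : (1 + m)%:~R * p z = p z + m%:~R * p z by rewrite intrD mulrDl mul1r.
  have -> : (1 - m)%:~R * p z = p z - m%:~R * p z by rewrite intrB mulrBl mul1r.
  rewrite sinB sinD.
  by field; rewrite expf_neq0.
rewrite box_int_sum; last by cont.
rewrite big1// => i _; rewrite box_intZ; last by cont.
rewrite box_intD; [|by cont|by cont].
by rewrite !H addr0 mulr0.
Qed.

Lemma sine_orthogonal_int (f : R * R -> R) : continuous f ->
  (forall j k, \int[area R]_(z in M) (f z * sine_mode j k z) = 0) ->
  forall l m : int,
    \int[area R]_(z in M) (f z * sin (m%:~R * z.2) * sin (l%:~R * z.1)) = 0.
Proof.
move=> cf H l m.
have H0 (l' m' : nat) (s : R) :
    \int[area R]_(z in M) (s * (f z * sin (m'%:R * z.2) * sin (l'%:R * z.1))) = 0.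
  rewrite box_intZ; last by cont.
  have int0 (g : R * R -> R) : (forall z, g z = 0) -> \int[area R]_(z in M) g z = 0.
    by move=> g0; rewrite /Rintegral integral0_eq// => z _; rewrite g0.
  case: l' => [|j]; first by rewrite int0 ?mulr0// => z; rewrite mul0r sin0 mulr0.
  case: m' => [|k].
    by rewrite int0 ?mulr0// => z; rewrite mul0r sin0 mulr0 mul0r.
  rewrite -[RHS](mulr0 s) -[in RHS](H j k); congr (_ * _).
  by apply: eq_Rintegral => z _; rewrite /sine_mode; ring.
case: l m => [l|l] [m|m].
- rewrite -[RHS](H0 l m 1); by apply: eq_Rintegral => z _; rewrite mul1r.
- rewrite -[RHS](H0 l m.+1 (-1)); apply: eq_Rintegral => z _.
  by rewrite NegzE mulrNz mulNr sinN; ring.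
- rewrite -[RHS](H0 l.+1 m (-1)); apply: eq_Rintegral => z _.
  by rewrite NegzE mulrNz mulNr sinN; ring.
- rewrite -[RHS](H0 l.+1 m.+1 1); apply: eq_Rintegral => z _.
  by rewrite !NegzE !mulrNz !mulNr !sinN; ring.
Qed.

Lemma kern2_orthogonal (f : R * R -> R) n (x0 y0 : R) : continuous f ->
  (forall j k, \int[area R]_(z in M) (f z * sine_mode j k z) = 0) ->
  \int[area R]_(z in M)
    (f z * (sin z.1 * sin z.2) * (kern n x0 z.1 * kern n y0 z.2)) = 0.
Proof.
move=> cf H; have Hint := sine_orthogonal_int f cf H.
have ck1 : continuous (fun z : R * R => kern n x0 z.1).
  by apply: cont_fst; exact: kern_cont.
transitivity (\int[area R]_(z in M)
    (f z * (sin z.1 * kern n x0 z.1) * (sin z.2 * kern n y0 z.2))).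
  by apply: eq_Rintegral => z _; ring.
apply: kern_orthogonal; [by cont|by cont|move=> m].
transitivity (\int[area R]_(z in M)
    (f z * sin (m%:~R * z.2) * (sin z.1 * kern n x0 z.1))).
  by apply: eq_Rintegral => z _; ring.
by apply: kern_orthogonal; [by cont|by cont|move=> l; exact: Hint].
Qed.

(** If [F] were positive at [(x0, y0)], it would be at least some [q > 0] on
    the box of half-side [d].  The box of half-side [d / 2] then contributes at
    least a multiple of [s ^ (2 n)] to the integral, and the complement of the
    large box at least minus a multiple of [c ^ (2 n)], where [c < s]. *)
Lemma kernel_concentration (F : R * R -> R) (x0 y0 : R) : continuous F ->
  0 < x0 < pi -> 0 < y0 < pi ->
  (forall n, \int[area R]_(z in M)
     (F z * (kern n x0 z.1 * kern n y0 z.2)) = 0) ->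
  F (x0, y0) <= 0.
Proof.
move=> cF /andP[x00 x0pi] /andP[y00 y0pi] orth; rewrite leNgt; apply/negP => Fz0.
have x0I : 0 <= x0 <= pi by rewrite !ltW.
have y0I : 0 <= y0 <= pi by rewrite !ltW.
have [q q0 [e /= e0 He]] : exists2 q : R, 0 < q & exists2 e : R, 0 < e &
    forall x y, `|x - x0| < e -> `|y - y0| < e -> q <= F (x, y).
  exists (F (x0, y0) / 2); first by rewrite divr_gt0.
  have /cvgrPdist_lt/(_ (F (x0, y0) / 2)) := cF (x0, y0).
  rewrite divr_gt0// => /(_ isT) /nbhs_ballP[e /= e0 He].
  exists e => // x y xe ye.
  have := He (x, y); have B : ball (x0, y0) e (x, y) by split; rewrite /ball /= distrC.
  by move=> /(_ B); rewrite /= ltr_norml => /andP[_]; lra.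
have [d [[d0 dle] [d2 d3 d4 d5]]] : exists d : R, (0 < d /\ d <= e / 2) /\
    [/\ d <= x0, d <= pi - x0, d <= y0 & d <= pi - y0].
  exists (Num.min (e / 2) (Num.min (Num.min x0 (pi - x0)) (Num.min y0 (pi - y0)))).
  split; last by split; rewrite !ge_min lexx ?orbT.
  by rewrite !lt_min divr_gt0// x00 y00 !subr_gt0 x0pi y0pi ge_min lexx.
have dh0 : 0 < d / 2 by rewrite divr_gt0.
have de : d < e by apply: le_lt_trans dle _; lra.
have dhe : d / 2 < e by apply: le_lt_trans de; lra.
have dhpi : d / 2 <= pi by lra.
have BM : box (x0 - d / 2) (x0 + d / 2) (y0 - d / 2) (y0 + d / 2) `<=` M.
  by apply: subset_box; lra.
have [dx dy] : x0 - d / 2 <= x0 + d / 2 /\ y0 - d / 2 <= y0 + d / 2 by split; lra.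
(* with c = cos (d / 2), peak n is (c ^+ 2) ^+ n at distance d but
   ((1 + c) / 2) ^+ n at distance d / 2, and c < (1 + c) / 2 *)
have [c /andP[c0 c1] [peakd peakd2]] : exists2 c : R, 0 < c < 1 &
    (forall n, peak n d = (c ^+ 2) ^+ n) /\
    (forall n, peak n (d / 2) = ((1 + c) / 2) ^+ n).
  exists (cos (d / 2)); last split => // n.
    apply/andP; split; first by apply: cos_gt0_pihalf; apply/andP; split; lra.
    rewrite -[X in _ < X]cos0 ltr_cos ?in_itv /=; [by lra|..];
      by apply/andP; split; lra.
  rewrite /peak; congr (_ ^+ n).
  have -> : cos d = cos (d / 2) ^+ 2 *+ 2 - 1.
    by rewrite -cos_mulr2n mulr2n -splitr.
  by rewrite -mulr_natr; field.
have [K K0 HK] := bounded_box F 0 pi 0 pi cF.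
have [s cs peaks] : exists2 s : R, c < s & forall n, peak n (d / 2) = s ^+ n.
  by exists ((1 + c) / 2) => //; lra.
have s0 : 0 < s by exact: lt_trans cs.
(* the comparison that fails for large n *)
have key n : (d ^+ 2 * q / 4) * (s ^+ 2) ^+ n <= K * pi ^+ 2 * (c ^+ 2) ^+ n.
  pose G z := F z * (kern n x0 z.1 * kern n y0 z.2) + K * (c ^+ 2) ^+ n.
  have ck1 : continuous (fun z : R * R => kern n x0 z.1).
    by apply: cont_fst; exact: kern_cont.
  have ck2 : continuous (fun z : R * R => kern n y0 z.2).
    by apply: cont_snd; exact: kern_cont.
  have cG : continuous G by rewrite /G; cont.
  have GM : \int[area R]_(z in M) G z = K * pi ^+ 2 * (c ^+ 2) ^+ n.
    rewrite box_intD; [|by cont|by cont].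
    rewrite orth add0r box_int_cst ?pi_ge0// subr0; ring.
  rewrite -GM.
  have cn0 : 0 <= (c ^+ 2) ^+ n by rewrite exprn_ge0// sqr_ge0.
  have Kc : 0 <= K * (c ^+ 2) ^+ n by rewrite mulr_ge0// ltW.
  have sn0 : 0 <= s ^+ n / 2 by rewrite divr_ge0// exprn_ge0// ltW.
  apply: (@le_trans _ _ (\int[area R]_(z in box (x0 - d / 2) (x0 + d / 2) (y0 - d / 2)
      (y0 + d / 2)) G z)); last first.
    apply: Rintegral_le_subset.
    - exact: measurable_box.
    - exact: measurable_box.
    - exact: box_integrable.
    - exact: BM.
    move=> z Mz _; rewrite /G.
    have k0 : 0 <= kern n x0 z.1 * kern n y0 z.2 by rewrite mulr_ge0// kern_ge0.
    have [Bz|nBz] := pselect (box (x0 - d) (x0 + d) (y0 - d) (y0 + d) z).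
      rewrite addr_ge0// mulr_ge0//; apply: (le_trans (ltW q0)).
      case: z {Mz k0} Bz => x y [] /=; rewrite !in_itv /= -!ler_distl => hx hy.
      by apply: He; [exact: le_lt_trans hx de|exact: le_lt_trans hy de].
    have := kern2_far n _ _ _ _ x0I y0I (ltW d0) Mz nBz; rewrite peakd => k1.
    have := HK _ Mz; rewrite ler_norml => /andP[F1 _].
    have H1 : K * (kern n x0 z.1 * kern n y0 z.2) <= K * (c ^+ 2) ^+ n.
      by rewrite ler_wpM2l// ltW.
    have H2 : - K * (kern n x0 z.1 * kern n y0 z.2) <= F z * (kern n x0 z.1 * kern n y0
        z.2).
      by rewrite ler_wpM2r.
    by rewrite -lerBlDr sub0r (le_trans _ H2)// mulNr lerN2.
  have -> : d ^+ 2 * q / 4 * (s ^+ 2) ^+ n = q * ((s ^+ n / 2) * (s ^+ n / 2)) *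
     ((x0 + d / 2 - (x0 - d / 2)) * (y0 + d / 2 - (y0 - d / 2))).
    by rewrite exprAC; field.
  rewrite -(@box_int_cst R _ (x0 - d / 2) (x0 + d / 2)); [|exact: dx|exact: dy].
  apply: box_int_le => //; first by cont.
  move=> [x y] [] /=; rewrite !in_itv /= -!ler_distl => hx hy.
  rewrite /G /=; rewrite -[X in X <= _]addr0; apply: lerD => //.
  have near (u u0 : R) : `|u - u0| <= d / 2 -> s ^+ n / 2 <= kern n u0 u.
    move=> h; apply: le_trans (kern_ge_half n u0 u).
    rewrite ler_pM2r ?invr_gt0// -peaks.
    apply: peak_le; rewrite -(cos_norm (u - u0)).
    by rewrite leNgt ltr_cos -?leNgt// in_itv /= ?normr_ge0 ?(le_trans h)// ltW.
  apply: ler_pM; [exact: ltW|by rewrite mulr_ge0| |by apply: ler_pM => //; apply: near].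
  by apply: He; [exact: le_lt_trans hx dhe|exact: le_lt_trans hy dhe].
pose r := c ^+ 2 / s ^+ 2.
have s20 : 0 < s ^+ 2 by rewrite exprn_gt0.
have r1 : `|r| < 1.
  rewrite ger0_norm ?divr_ge0 ?sqr_ge0// ltr_pdivrMr// mul1r.
  by rewrite ltr_sqr// nnegrE ltW.
have b0 : 0 < d ^+ 2 * q / 4 by rewrite divr_gt0// mulr_gt0// exprn_gt0.
have a0 : 0 < K * pi ^+ 2 by rewrite mulr_gt0// exprn_gt0// pi_gt0.
have [n Hn] : exists n, r ^+ n < d ^+ 2 * q / 4 / (K * pi ^+ 2).
  have /cvgrPdist_lt/(_ (d ^+ 2 * q / 4 / (K * pi ^+ 2))) := cvg_expr r1.
  rewrite divr_gt0// => /(_ isT)[n _ Hn]; exists n.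
  have := Hn n (leqnn n); rewrite /= sub0r normrN; apply: le_lt_trans.
  exact: ler_norm.
have := key n; rewrite leNgt => /negP; apply.
move: Hn; rewrite /r expr_div_n ltr_pdivrMr ?exprn_gt0// mulrAC ltr_pdivlMr//.
by rewrite [X in X < _]mulrC.
Qed.

Lemma sine_complete_pos (f : R * R -> R) : continuous f ->
  (forall j k, \int[area R]_(z in M) (f z * sine_mode j k z) = 0) ->
  forall z, open_square R z -> f z <= 0.
Proof.
move=> cf H [x0 y0] [] /= x0I y0I.
have : f (x0, y0) * (sin x0 * sin y0) <= 0.
  apply: (@kernel_concentration (fun z => f z * (sin z.1 * sin z.2))) => //.
    by cont.
  by move=> n; exact: kern2_orthogonal.
by rewrite pmulr_lle0// mulr_gt0// sin_gt0_pi.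
Qed.

Lemma sine_complete (f : R * R -> R) : continuous f ->
  (forall j k, \int[area R]_(z in M) (f z * sine_mode j k z) = 0) ->
  forall z, open_square R z -> f z = 0.
Proof.
move=> cf H z oz; apply/eqP; rewrite eq_le (sine_complete_pos f)//=.
rewrite -oppr_le0; apply: (sine_complete_pos (fun z => - f z)) => //; first by cont.
move=> j k; rewrite -[RHS](mulr0 (-1)) -[in RHS](H j k) -box_intZ.
  by apply: eq_Rintegral => w _; rewrite mulN1r mulNr.
by apply: contM => //; exact: cont_sine_mode.
Qed.

End completeness.

(** * Green formula for dilated eigenfunctions *)

Section bounded_convergence.
Context d (T : measurableType d) {R : realType} (mu : {measure set T -> \bar R}).

Lemma Rintegral_bounded_cvg (D : set T) (f_ : nat -> T -> R) (f : T -> R) (K : R) :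
  measurable D -> (mu D < +oo)%E ->
  (forall n, measurable_fun D (f_ n)) -> mu.-integrable D (EFin \o f) ->
  (forall x, D x -> f_ n x @[n --> \oo] --> f x) ->
  (forall n x, D x -> `|f_ n x| <= K) ->
  \int[mu]_(x in D) f_ n x @[n --> \oo] --> \int[mu]_(x in D) f x.
Proof.
move=> mD muD mf If cf bf.
have IK : mu.-integrable D (EFin \o cst K).
  apply: measurable_bounded_integrable => //.
  exists `|K|; split; first exact: num_real.
  by move=> M KM x _; exact: ltW.
apply: fine_cvg; rewrite fineK; last exact: integrable_fin_num.
apply: (@dominated_cvg _ _ _ mu D mD (fun n => EFin \o f_ n) _ (EFin \o cst K)) => //.
- by move=> n; apply: measurableT_comp.
- by move=> x Dx; apply: cvg_EFin; [exact: nearW|exact: cf].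
Qed.

End bounded_convergence.

Section dirichlet.
Context {R : realType}.
Local Notation mu := (@lebesgue_measure R).
Local Notation M := (box (0:R) pi 0 pi).

Definition real_dirichlet (lambda : R) (f : R * R -> R) : Prop :=
  [/\ {within closed_square R, continuous f}, C2_on (@open_square R) f,
      forall p, open_square R p -> - laplacian f p = lambda * f p &
      forall p, (closed_square R `\` open_square R) p -> f p = 0].

Lemma box_closed_square : M = closed_square R.
Proof.
apply/seteqP; split => -[x y] [];
  by rewrite /= ?in_itv /= => h1 h2; split; rewrite /= ?in_itv.
Qed.

Lemma is_derive_partial1 (f : R * R -> R) x y : derivable f (x, y) (1, 0) ->
  is_derive x 1 (fun t => f (t, y)) ('D_(1, 0) f (x, y)).
Proof.
have E : (fun h : R => h^-1 *: (((fun t => f (t, y)) \o shift x) (h *: (1:R)) - f (x, y))) =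
   (fun h : R => h^-1 *: ((f \o shift (x, y)) (h *: ((1, 0) : R * R)) - f (x, y))).
  apply/funext => h /=; congr (_ *: (f _ - _)).
  have -> : h *: ((1, 0) : R * R) + (x, y) = (h * 1 + x, h * 0 + y) by [].
  by rewrite mulr0 add0r.
by move=> df; apply: DeriveDef; rewrite /derivable /derive E.
Qed.

Lemma is_derive_partial2 (f : R * R -> R) x y : derivable f (x, y) (0, 1) ->
  is_derive y 1 (fun t => f (x, t)) ('D_(0, 1) f (x, y)).
Proof.
have E : (fun h : R => h^-1 *: (((fun t => f (x, t)) \o shift y) (h *: (1:R)) - f (x, y))) =
   (fun h : R => h^-1 *: ((f \o shift (x, y)) (h *: ((0, 1) : R * R)) - f (x, y))).
  apply/funext => h /=; congr (_ *: (f _ - _)).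
  have -> : h *: ((0, 1) : R * R) + (x, y) = (h * 0 + x, h * 1 + y) by [].
  by rewrite mulr0 add0r.
by move=> df; apply: DeriveDef; rewrite /derivable /derive E.
Qed.

(** The homothety of ratio [r] centred at the middle of [[0, pi]]. *)
Definition dil (r t : R) : R := pi / 2 + r * (t - pi / 2).

Lemma dil_cont (r : R) : continuous (dil r).
Proof. by rewrite /dil; cont. Qed.

Lemma dil_in (r t : R) : 0 < r < 1 -> 0 <= t <= pi -> 0 < dil r t < pi.
Proof.
move=> /andP[r0 r1] /andP[t0 t1]; have p0 := @pi_gt0 R.
have h1 : r * (t - pi / 2) <= r * (pi / 2) by rewrite ler_pM2l//; lra.
have h2 : r * (- (pi / 2)) <= r * (t - pi / 2) by rewrite ler_pM2l//; lra.
have h3 : r * (pi / 2) < pi / 2 by rewrite gtr_pMl// divr_gt0.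
by rewrite /dil; apply/andP; split; lra.
Qed.

Lemma is_derive_dil (r t : R) : is_derive t 1 (dil r) r.
Proof.
have h : is_derive t 1 (fun x => x - pi / 2) 1.
  by apply: is_derive_eq; rewrite ?subr0//; exact: subr0.
have := @is_deriveD _ _ _ (cst (pi / 2)) _ t 1 0 _ (is_derive_cst _ _ _)
  (@is_deriveZ _ _ _ (fun x => x - pi / 2) r t 1 1 h).
by rewrite add0r /GRing.scale /= mulr1.
Qed.

Lemma is_derive_val (f : R -> R) (x a b : R) :
  is_derive x 1 f a -> a = b -> is_derive x 1 f b.
Proof. by move=> + <-. Qed.

(** Integration by parts twice against [sin (k x)], which vanishes at both ends
    so that the values of [g1] there do not appear.  The function [h] is a
    globally continuous version of [g2 + k ^ 2 g]. *)
Lemma green_sine (g g1 g2 h : R -> R) (k : nat) :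
  (forall x, 0 <= x <= pi -> is_derive x 1 g (g1 x)) ->
  (forall x, 0 <= x <= pi -> is_derive x 1 g1 (g2 x)) ->
  continuous h ->
  (forall x, 0 <= x <= pi -> h x = g2 x + k%:R ^+ 2 * g x) ->
  \int[mu]_(x in `[0, pi]) (h x * sin (k%:R * x)) =
  k%:R * (g 0 - cos (k%:R * pi) * g pi).
Proof.
move=> dg dg1 ch hE.
pose F (x : R) := g1 x * sin (k%:R * (x - 0)) - g x * (k%:R * cos (k%:R * (x - 0))).
transitivity (F pi - F 0); last first.
  rewrite /F !subr0 mulr0 sin0 cos0.
  have -> : sin (k%:R * pi) = 0 :> R by exact: (sin_intpi k).
  ring.
apply: segment_FTC; first exact: pi_ge0.
  by apply: continuous_subspaceT; cont.
move=> x xI.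
have d1 := is_deriveM (dg1 x xI) (is_derive_sin_affine k%:R 0 x).
have d2 := @is_deriveZ _ _ _ _ k%:R x 1 _ (is_derive_cos_affine k%:R 0 x).
have d3 := is_deriveM (dg x xI) d2.
apply: (is_derive_val F x _ _ (is_deriveB d1 d3)).
by rewrite /GRing.scale /= !subr0 hE// /GRing.scale /=; ring.
Qed.

(** The dilated function satisfies the eigenvalue equation with
    [r ^ 2 * lambda] on a neighbourhood of the square, so that [green_sine]
    applies on every horizontal and vertical segment.  The right-hand side only
    involves boundary values. *)
Lemma eigen_dilated (lambda r : R) (f : R * R -> R) (j k : nat) :
  real_dirichlet lambda f -> 0 < r < 1 ->
  let U z := (f \o box_clamp 0 pi 0 pi) (dil r z.1, dil r z.2) in
  (j.+1%:R ^+ 2 + k.+1%:R ^+ 2 - r ^+ 2 * lambda) *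
    \int[area R]_(z in M) (U z * sine_mode j k z) =
  j.+1%:R * \int[mu]_(y in `[0, pi])
     ((U (0, y) - cos (j.+1%:R * pi) * U (pi, y)) * sin (k.+1%:R * y)) +
  k.+1%:R * \int[mu]_(x in `[0, pi])
     ((U (x, 0) - cos (k.+1%:R * pi) * U (x, pi)) * sin (j.+1%:R * x)).
Proof.
move=> [cf C2f eigf f0] r01 U.
have p0 := @pi_ge0 R.
pose A (z : R * R) := (dil r z.1, dil r z.2).
have cA : continuous A.
  by apply: pair_cont; [apply: cont_fst|apply: cont_snd]; exact: dil_cont.
have Ain z : M z -> open_square R (A z).
  by case: z => x y []; rewrite /= !in_itv /= => hx hy; split; exact: dil_in.
have openM z : open_square R z -> M z.
  case: z => x y [] /= /andP[? ?] /andP[? ?].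
  by split; rewrite /= in_itv /= !ltW.
have UE z : M z -> U z = f (A z).
  by move=> Mz; rewrite /U /= box_clamp_id//; exact/openM/Ain.
have cF : continuous (f \o box_clamp 0 pi 0 pi).
  exact: box_clamp_continuous.
have cU : continuous U.
  by move=> z; apply: (@continuous_comp _ _ _ A (f \o box_clamp 0 pi 0 pi));
    [exact: cA|exact: cF].
pose D v : R * R -> R := (fun z => 'D_v ('D_v f) (A z)) \o box_clamp 0 pi 0 pi.
have cD v : continuous (D v).
  apply: box_clamp_continuous => //; apply: continuous_in_subspaceT => z /set_mem Mz.
  apply: (@continuous_comp _ _ _ A ('D_v ('D_v f))); first exact: cA.
  by have [_ /(_ v v)[]] := C2f _ (Ain _ Mz).
have DE v z : M z -> D v z = 'D_v ('D_v f) (A z).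
  by move=> Mz; rewrite /D /= box_clamp_id.
have Mxy x y : 0 <= x <= pi -> 0 <= y <= pi -> M (x, y).
  by move=> hx hy; split; rewrite /= in_itv.
have zI : 0 <= (0 : R) <= pi by rewrite lexx p0.
have pI : 0 <= (pi : R) <= pi by rewrite lexx p0.
pose h1 z := r ^+ 2 * D (1, 0) z + j.+1%:R ^+ 2 * U z.
pose h2 z := r ^+ 2 * D (0, 1) z + k.+1%:R ^+ 2 * U z.
clearbody D U.
have cD1 := cD (1, 0); have cD2 := cD (0, 1).
have ch1 : continuous h1 by rewrite /h1; cont.
have ch2 : continuous h2 by rewrite /h2; cont.
have cm := @cont_sine_mode R j k.
have E1 : \int[area R]_(z in M) (h1 z * sine_mode j k z) =
  j.+1%:R * \int[mu]_(y in `[0, pi])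
     ((U (0, y) - cos (j.+1%:R * pi) * U (pi, y)) * sin (k.+1%:R * y)).
  have cU1 x : continuous (fun y => U (x, y)) by exact: cont_pairr.
  rewrite box_fubini21; last by cont.
  rewrite -seg_intZ; last by cont.
  apply: eq_seg_int => y yI.
  have ch1y : continuous (fun x => h1 (x, y)) by exact: cont_pairl.
  transitivity (\int[mu]_(x in `[0, pi]) (sin (k.+1%:R * y) * (h1 (x, y) * sin (j.+1%:R *
      x)))).
    by apply: eq_Rintegral => x _; rewrite /sine_mode /=; ring.
  rewrite seg_intZ; last by cont.
  have -> : \int[mu]_(x in `[0, pi]) (h1 (x, y) * sin (j.+1%:R * x)) =
      j.+1%:R * (f (A (0, y)) - cos (j.+1%:R * pi) * f (A (pi, y))); last first.
    by rewrite !UE; [ring|exact: Mxy|exact: Mxy].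
  apply: (@green_sine (fun x => f (A (x, y))) (fun x => 'D_(1, 0) f (A (x, y)) * r)
     (fun x => 'D_(1, 0) ('D_(1, 0) f) (A (x, y)) * r * r) (fun x => h1 (x, y))).
  - move=> x xI; have [_ /(_ (1, 0) (1, 0))[d1 _ _ _]] := C2f _ (Ain _ (Mxy _ _ xI yI)).
    exact: (@is_derive1_comp _ (fun t => f (t, dil r y)) (dil r) x _ _
        (is_derive_partial1 _ _ _ d1) (is_derive_dil r x)).
  - move=> x xI; have [_ /(_ (1, 0) (1, 0))[_ _ d1 _]] := C2f _ (Ain _ (Mxy _ _ xI yI)).
    have := @is_derive1_comp _ (fun t => 'D_(1, 0) f (t, dil r y)) (dil r) x _ _
        (is_derive_partial1 _ _ _ d1) (is_derive_dil r x).
    move=> d2; have := @is_deriveZ _ _ _ _ r x 1 _ d2.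
    rewrite [X in is_derive _ _ X _](_ : _ = fun x => 'D_(1, 0) f (A (x, y)) * r); last
        first.
      by apply/funext => t; rewrite /= [LHS]mulrC.
    by move=> d3; apply: (is_derive_val _ _ _ _ d3); rewrite /GRing.scale /= mulrC.
  - exact: ch1y.
  - move=> x xI; rewrite /h1 UE ?DE; [ring|exact: Mxy..].
have E2 : \int[area R]_(z in M) (h2 z * sine_mode j k z) =
  k.+1%:R * \int[mu]_(x in `[0, pi])
     ((U (x, 0) - cos (k.+1%:R * pi) * U (x, pi)) * sin (j.+1%:R * x)).
  have cU1 y : continuous (fun x => U (x, y)) by exact: cont_pairl.
  rewrite box_fubini12; last by cont.
  rewrite -seg_intZ; last by cont.
  apply: eq_seg_int => x xI.
  have ch2x : continuous (fun y => h2 (x, y)) by exact: cont_pairr.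
  transitivity (\int[mu]_(y in `[0, pi]) (sin (j.+1%:R * x) * (h2 (x, y) * sin (k.+1%:R *
      y)))).
    by apply: eq_Rintegral => y _; rewrite /sine_mode /=; ring.
  rewrite seg_intZ; last by cont.
  have -> : \int[mu]_(y in `[0, pi]) (h2 (x, y) * sin (k.+1%:R * y)) =
      k.+1%:R * (f (A (x, 0)) - cos (k.+1%:R * pi) * f (A (x, pi))); last first.
    by rewrite !UE; [ring|exact: Mxy|exact: Mxy].
  apply: (@green_sine (fun y => f (A (x, y))) (fun y => 'D_(0, 1) f (A (x, y)) * r)
     (fun y => 'D_(0, 1) ('D_(0, 1) f) (A (x, y)) * r * r) (fun y => h2 (x, y))).
  - move=> y yI; have [_ /(_ (0, 1) (0, 1))[d1 _ _ _]] := C2f _ (Ain _ (Mxy _ _ xI yI)).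
    exact: (@is_derive1_comp _ (fun t => f (dil r x, t)) (dil r) y _ _
        (is_derive_partial2 _ _ _ d1) (is_derive_dil r y)).
  - move=> y yI; have [_ /(_ (0, 1) (0, 1))[_ _ d1 _]] := C2f _ (Ain _ (Mxy _ _ xI yI)).
    have := @is_derive1_comp _ (fun t => 'D_(0, 1) f (dil r x, t)) (dil r) y _ _
        (is_derive_partial2 _ _ _ d1) (is_derive_dil r y).
    move=> d2; have := @is_deriveZ _ _ _ _ r y 1 _ d2.
    rewrite [X in is_derive _ _ X _](_ : _ = fun y => 'D_(0, 1) f (A (x, y)) * r); last
        first.
      by apply/funext => t; rewrite /= [LHS]mulrC.
    by move=> d3; apply: (is_derive_val _ _ _ _ d3); rewrite /GRing.scale /= mulrC.
  - exact: ch2x.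
  - move=> y yI; rewrite /h2 UE ?DE; [ring|exact: Mxy..].
rewrite -E1 -E2 -box_intZ; last by cont.
rewrite -box_intD; [|by cont|by cont].
apply: eq_box_int => z Mz.
have := eigf _ (Ain _ Mz); rewrite /laplacian -!DE// -UE// => eig.
have -> : h1 z = r ^+ 2 * D (1, 0) z + j.+1%:R ^+ 2 * U z by [].
have -> : h2 z = r ^+ 2 * D (0, 1) z + k.+1%:R ^+ 2 * U z by [].
have -> : D (1, 0) z = - D (0, 1) z - lambda * U z by rewrite -eig; ring.
ring.
Qed.

End dirichlet.

(** * Eigenfunctions are finite sine sums *)

Section expansion.
Context {R : realType}.
Local Notation mu := (@lebesgue_measure R).
Local Notation M := (box (0:R) pi 0 pi).

Lemma cvg_dil (r : nat -> R) t : r n @[n --> \oo] --> (1 : R) ->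
  dil (r n) t @[n --> \oo] --> t.
Proof.
move=> r1; rewrite [X in _ --> X](_ : t = pi / 2 + 1 * (t - pi / 2)); last by ring.
by apply: cvgD; [exact: cvg_cst|apply: cvgM => //; exact: cvg_cst].
Qed.

(** The limit of [eigen_dilated] as [r] tends to [1]: the dilated functions
    converge boundedly to [f], which vanishes on the boundary. *)
Lemma eigen_fourier (lambda : R) (f : R * R -> R) (j k : nat) :
  real_dirichlet lambda f ->
  (j.+1%:R ^+ 2 + k.+1%:R ^+ 2 - lambda) *
    \int[area R]_(z in M) ((f \o box_clamp 0 pi 0 pi) z * sine_mode j k z) = 0.
Proof.
move=> Hf; have [cf _ _ f0] := Hf; have p0 := @pi_ge0 R.
set F := f \o box_clamp 0 pi 0 pi.
have cF : continuous F by exact: box_clamp_continuous.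
pose r n : R := 1 - harmonic n / 2.
have r01 n : 0 < r n < 1.
  have h0 : 0 < harmonic n :> R by rewrite /harmonic /= invr_gt0 ltr0n.
  have h1 : harmonic n <= 1 :> R by rewrite /harmonic /= invf_le1 ?ltr0n// ler1n.
  by rewrite /r; apply/andP; split; lra.
have r1 : r n @[n --> \oo] --> (1 : R).
  rewrite [X in _ --> X](_ : 1 = 1 - 0 / 2); last by rewrite mul0r subr0.
  apply: cvgB; first exact: cvg_cst.
  by apply: cvgM; [exact: cvg_harmonic|exact: cvg_cst].
pose U n z := F (dil (r n) z.1, dil (r n) z.2).
have cU n : continuous (U n).
  move=> z; apply: (@continuous_comp _ _ _ (fun z : R * R => (dil (r n) z.1, dil (r n)
      z.2)) F); last exact: cF.
  by apply: pair_cont; [apply: cont_fst|apply: cont_snd]; exact: dil_cont.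
have [K K0 HK] := bounded_box F 0 pi 0 pi cF.
have Mxy (x y : R) : 0 <= x <= pi -> 0 <= y <= pi -> M (x, y).
  by move=> hx hy; split; rewrite /= in_itv.
have UK n z : M z -> `|U n z| <= K.
  case: z => x y []; rewrite /= !in_itv /= => hx hy; apply: HK; apply: Mxy.
    by have /andP[h1 h2] := dil_in _ _ (r01 n) hx; rewrite !ltW.
  by have /andP[h1 h2] := dil_in _ _ (r01 n) hy; rewrite !ltW.
have Ucvg z : U n z @[n --> \oo] --> F z.
  case: z => x y.
  apply: (@continuous_cvg _ _ _ _ _ (fun n => (dil (r n) x, dil (r n) y)) F (x, y));
      first exact: cF.
  by apply: (@cvg_pair _ _ _ _ (nbhs x) (nbhs y)); exact: cvg_dil.
have cm := @cont_sine_mode R j k.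
have X1 : \int[area R]_(z in M) (U n z * sine_mode j k z) @[n --> \oo] -->
    \int[area R]_(z in M) (F z * sine_mode j k z).
  apply: (@Rintegral_bounded_cvg _ _ _ _ _ _ _ K).
  - exact: measurable_box.
  - exact: area_box_lty.
  - by move=> n; apply: measurable_funTS; apply: plane_continuous_measurable; have := cU
      n => ?; cont.
  - by apply: box_integrable; cont.
  - by move=> z _; apply: cvgM => //; exact: cvg_cst.
  - move=> n z Mz; rewrite normrM -[X in _ <= X]mulr1.
    apply: ler_pM => //; first exact: UK.
    by rewrite /sine_mode normrM mulr_ile1// sin_max.
have side (c s : R) (p q : R -> R * R) : `|c| <= 1 ->
    continuous p -> continuous q ->
    (forall t, 0 <= t <= pi -> M (p t)) -> (forall t, 0 <= t <= pi -> M (q t)) ->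
    (forall t, 0 <= t <= pi -> F (p t) = 0) -> (forall t, 0 <= t <= pi -> F (q t) = 0) ->
    \int[mu]_(t in `[0, pi]) ((U n (p t) - c * U n (q t)) * sin (s * t)) @[n --> \oo] -->
        (0 : R).
  move=> c1 cp cq Mp Mq Fp Fq.
  have cUp n : continuous (fun t => U n (p t)).
    by move=> t; apply: (@continuous_comp _ _ _ p (U n)); [exact: cp|exact: cU].
  have cUq n : continuous (fun t => U n (q t)).
    by move=> t; apply: (@continuous_comp _ _ _ q (U n)); [exact: cq|exact: cU].
  have cFp : continuous (fun t => F (p t)).
    by move=> t; apply: (@continuous_comp _ _ _ p F); [exact: cp|exact: cF].
  have cFq : continuous (fun t => F (q t)).
    by move=> t; apply: (@continuous_comp _ _ _ q F); [exact: cq|exact: cF].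
  have I0 : \int[mu]_(t in `[0, pi]) ((F (p t) - c * F (q t)) * sin (s * t)) = 0.
    rewrite (@eq_seg_int _ _ (fun=> 0)); first by rewrite seg_int_cst// mul0r.
    by move=> t tI; rewrite Fp// Fq// mulr0 subr0 mul0r.
  rewrite -[X in _ --> X]I0; apply: (@Rintegral_bounded_cvg _ _ _ _ _ _ _ (K + K)).
  - exact: measurable_itv.
  - by apply: compact_finite_measure; exact: segment_compact.
  - move=> n; apply: measurable_funTS; apply: continuous_measurable_fun.
    by have := cUp n; have := cUq n => ? ?; cont.
  - by apply: segment_integrable; cont.
  - move=> t _; apply: cvgM; last exact: cvg_cst.
    by apply: cvgB => //; apply: cvgM => //; exact: cvg_cst.
  - move=> n t; rewrite /= in_itv /= => tI; rewrite normrM -[X in _ <= X]mulr1.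
    apply: ler_pM => //; last exact: sin_max.
    apply: le_trans (ler_normB _ _) _; apply: lerD; first exact: UK (Mp _ tI).
    rewrite normrM -[X in _ <= X]mul1r; apply: ler_pM => //.
    exact: UK (Mq _ tI).
have F0 z : M z -> ~ open_square R z -> F z = 0.
  move=> Mz oz; rewrite /F /= box_clamp_id//; apply: f0.
  by split; [rewrite -box_closed_square|].
have cosb : `|cos (j.+1%:R * pi : R)| <= 1 /\ `|cos (k.+1%:R * pi : R)| <= 1.
  by split; exact: cos_max.
have pI : 0 <= (pi : R) <= pi by rewrite lexx p0.
have zI : 0 <= (0 : R) <= pi by rewrite lexx p0.
have Fl t : 0 <= t <= pi -> F (0, t) = 0.
  by move=> tI; apply: F0; [exact: Mxy|case; rewrite /= ltxx].
have Fr t : 0 <= t <= pi -> F (pi, t) = 0.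
  by move=> tI; apply: F0; [exact: Mxy|case; rewrite /= ltxx andbF].
have Fd t : 0 <= t <= pi -> F (t, 0) = 0.
  by move=> tI; apply: F0; [exact: Mxy|case; rewrite /= ltxx].
have Fu t : 0 <= t <= pi -> F (t, pi) = 0.
  by move=> tI; apply: F0; [exact: Mxy|case; rewrite /= ltxx andbF].
have Y1 := side (cos (j.+1%:R * pi)) k.+1%:R (fun t => (0, t)) (fun t => (pi, t)) cosb.1
  (pairr_cont _) (pairr_cont _) (fun t tI => Mxy _ _ zI tI) (fun t tI => Mxy _ _ pI tI)
      Fl Fr.
have Z1 := side (cos (k.+1%:R * pi)) j.+1%:R (fun t => (t, 0)) (fun t => (t, pi)) cosb.2
  (pairl_cont _) (pairl_cont _) (fun t tI => Mxy _ _ tI zI) (fun t tI => Mxy _ _ tI pI)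
      Fd Fu.
have L1 : (j.+1%:R ^+ 2 + k.+1%:R ^+ 2 - r n ^+ 2 * lambda) *
    \int[area R]_(z in M) (U n z * sine_mode j k z) @[n --> \oo] -->
   (j.+1%:R ^+ 2 + k.+1%:R ^+ 2 - 1 ^+ 2 * lambda) *
    \int[area R]_(z in M) (F z * sine_mode j k z).
  apply: cvgM => //; apply: cvgB; first exact: cvg_cst.
  apply: cvgM; last exact: cvg_cst.
  by rewrite expr2; under eq_fun do rewrite expr2; exact: cvgM.
have L2 : (j.+1%:R ^+ 2 + k.+1%:R ^+ 2 - r n ^+ 2 * lambda) *
    \int[area R]_(z in M) (U n z * sine_mode j k z) @[n --> \oo] --> (j.+1%:R * 0 +
        k.+1%:R * 0 : R).
  rewrite (_ : (fun n => _) = (fun n => j.+1%:R * \int[mu]_(y in `[0, pi])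
     ((U n (0, y) - cos (j.+1%:R * pi) * U n (pi, y)) * sin (k.+1%:R * y)) +
  k.+1%:R * \int[mu]_(x in `[0, pi])
     ((U n (x, 0) - cos (k.+1%:R * pi) * U n (x, pi)) * sin (j.+1%:R * x)))); last first.
    by apply/funext => n; exact: (eigen_dilated _ _ _ _ _ Hf (r01 n)).
  apply: cvgD; (apply: cvgM; first exact: cvg_cst).
    exact: Y1.
  exact: Z1.
have := cvg_unique _ L1 L2; rewrite expr1n mul1r => ->//.
by rewrite !mulr0 addr0.
Qed.

Lemma sine_sum_coef N (a : 'I_N * 'I_N -> R) (j k : nat) :
  \int[area R]_(z in M) (sine_sum a z * sine_mode j k z) =
  (pi / 2) ^+ 2 * \sum_p a p * ((p.1 == j :> nat) && (p.2 == k :> nat))%:R.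
Proof.
have cm (i l : nat) := @cont_sine_mode R i l.
transitivity (\int[area R]_(z in M) \sum_p a p * (sine_mode p.1 p.2 z * sine_mode j k z)).
  apply: eq_Rintegral => z _; rewrite /sine_sum mulr_suml.
  by apply: eq_bigr => p _; rewrite mulrA.
rewrite box_int_sum; last by move=> p; have := cm p.1 p.2; have := cm j k => ? ?; cont.
rewrite mulr_sumr; apply: eq_bigr => p _.
rewrite box_intZ; last by have := cm p.1 p.2; have := cm j k => ? ?; cont.
transitivity (a p * \int[area R]_(z in M)
  ((sin (p.1.+1%:R * z.1) * sin (j.+1%:R * z.1)) * (sin (p.2.+1%:R * z.2) * sin (k.+1%:R
      * z.2)))).
  by congr (_ * _); apply: eq_Rintegral => z _; rewrite /sine_mode; ring.
rewrite (@box_intM _ (fun x => sin (p.1.+1%:R * x) * sin (j.+1%:R * x))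
  (fun x => sin (p.2.+1%:R * x) * sin (k.+1%:R * x))); [|by cont|by cont].
by rewrite !int_sinsin -mulnb natrM; ring.
Qed.

Lemma sin_natpi (n : nat) : sin (n%:R * pi) = 0 :> R.
Proof. exact: (sin_intpi n). Qed.

(** The coefficients with a frequency greater than [N] vanish by
    [eigen_fourier], as [lambda < N]; so [f] minus its partial sine
    sum has no nonzero sine coefficient. *)
Lemma dirichlet_sine_sum (lambda : R) (f : R * R -> R) N :
  real_dirichlet lambda f -> lambda < N%:R ->
  exists a : 'I_N * 'I_N -> R,
    (forall p, a p != 0 -> (p.1.+1 ^ 2 + p.2.+1 ^ 2)%N%:R = lambda) /\
    forall z, closed_square R z -> f z = sine_sum a z.
Proof.
move=> Hf lN; have [cf _ _ f0] := Hf; have p0 := @pi_ge0 R.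
pose F := f \o box_clamp 0 pi 0 pi.
have cF : continuous F by exact: box_clamp_continuous.
have pi2 : (pi / 2) ^+ 2 != 0 :> R by rewrite expf_neq0// mulf_neq0// gt_eqF// pi_gt0.
pose co (j k : nat) := ((pi / 2) ^+ 2)^-1 *
  \int[area R]_(z in M) (F z * sine_mode j k z).
have co0 (j k : nat) : co j k != 0 -> (j.+1 ^ 2 + k.+1 ^ 2)%N%:R = lambda.
  rewrite /co mulf_eq0 negb_or => /andP[_ I0].
  have /eqP := eigen_fourier _ _ j k Hf; rewrite mulf_eq0 (negbTE I0) orbF subr_eq0.
  by move=> /eqP <-; rewrite natrD !natrX.
exists (fun p : 'I_N * 'I_N => co p.1 p.2); split=> [p|]; first exact: co0.
set u := sine_sum _; have cu : continuous u by exact: cont_sine_sum.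
have oz z : open_square R z -> F z - u z = 0.
  apply: (@sine_complete _ (fun z => F z - u z)); first by cont.
  move=> j k; have cm := @cont_sine_mode R j k.
  transitivity (\int[area R]_(z in M) (F z * sine_mode j k z + -1 * (u z * sine_mode j k
      z))).
    by apply: eq_Rintegral => w _; ring.
  rewrite box_intD; [|by cont|by cont].
  rewrite box_intZ; last by cont.
  rewrite sine_sum_coef.
  have -> : \int[area R]_(z in M) (F z * sine_mode j k z) = (pi / 2) ^+ 2 * co j k.
    by rewrite /co mulrA divff// mul1r.
  have [jkN|jkN] := boolP ((j < N) && (k < N))%N.
    have /andP[jN kN] := jkN.
    rewrite (bigD1 (Ordinal jN, Ordinal kN)) //= !eqxx mulr1 big1 ?addr0; first by ring.
    move=> [p1 p2] ne; case: andP => [[/eqP e1 /eqP e2]|]; last by rewrite mulr0.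
    by case/eqP: ne; congr (_, _); apply: val_inj.
  have -> : co j k = 0.
    apply/eqP; apply: contraNT jkN => /co0 jkl.
    move: lN; rewrite -jkl ltr_nat => H.
    have sq (i : nat) : (i.+1 <= i.+1 ^ 2)%N by rewrite -mulnn leq_pmulr.
    by have := sq j; have := sq k; move: H; lia.
  rewrite mulr0 add0r big1 ?mulr0// => -[p1 p2] _ /=.
  case: andP => [[/eqP e1 /eqP e2]|]; last by rewrite mulr0.
  by move: jkN; rewrite -e1 -e2 !ltn_ord.
move=> z Mz; have [/oz|noz] := pselect (open_square R z).
  move=> /eqP; rewrite subr_eq0 /F /= box_clamp_id; first by move/eqP.
  by rewrite box_closed_square.
rewrite f0; last by split.
rewrite /u /sine_sum big1// => p _.
suff -> : sine_mode p.1 p.2 z = 0 by rewrite mulr0.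
rewrite /sine_mode.
case: z Mz noz => x y [/= /andP[x1 x2] /andP[y1 y2]] noz.
have [->|x0] := eqVneq x 0; first by rewrite mulr0 sin0 mul0r.
have [->|xp] := eqVneq x pi; first by rewrite sin_natpi mul0r.
have [->|y0] := eqVneq y 0; first by rewrite mulr0 sin0 mulr0.
have [->|yp] := eqVneq y pi; first by rewrite sin_natpi mulr0.
by exfalso; apply: noz; rewrite /open_square /= !lt_def x1 y1 x0 y0 x2 y2 (eq_sym pi x)
    (eq_sym pi y) xp yp.
Qed.

(** If some coefficient is nonzero then [lambda] is an integer [L]: either [L]
    exceeds the threshold [Lam] of the high frequency estimate, or the solution
    is a sine sum of size [Lam + 1], for which one low frequency constant
    serves all [L <= Lam]. *)
Lemma real_dirichlet_lower (x0 y0 d : R) :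
  0 < d -> 0 <= x0 - d -> x0 + d <= pi -> 0 <= y0 - d -> y0 + d <= pi ->
  exists2 c : R, 0 < c & forall lambda f, real_dirichlet lambda f ->
    c * \int[area R]_(z in M) (f z ^+ 2) <=
    \int[area R]_(z in box (x0 - d) (x0 + d) (y0 - d) (y0 + d)) (f z ^+ 2).
Proof.
move=> d0 hx1 hx2 hy1 hy2.
have [c1 c10 [Lam high]] := high_frequency_lower x0 y0 d d0 hx1 hx2 hy1 hy2.
have hx : x0 - d < x0 + d by lra.
have hy : y0 - d < y0 + d by lra.
have [c2 c20 low] := low_frequency_lower Lam.+1 _ _ _ _ hx hy.
exists (Num.min c1 c2); first by rewrite lt_min c10.
move=> lambda f Hf.
have BM : box (x0 - d) (x0 + d) (y0 - d) (y0 + d) `<=` M.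
  by apply: subset_box; lra.
have red N (a : 'I_N * 'I_N -> R) c : (forall z, closed_square R z -> f z = sine_sum a z) ->
    Num.min c1 c2 <= c ->
    c * \int[area R]_(z in M) (sine_sum a z ^+ 2) <=
    \int[area R]_(z in box (x0 - d) (x0 + d) (y0 - d) (y0 + d)) (sine_sum a z ^+ 2) ->
    Num.min c1 c2 * \int[area R]_(z in M) (f z ^+ 2) <=
    \int[area R]_(z in box (x0 - d) (x0 + d) (y0 - d) (y0 + d)) (f z ^+ 2).
  move=> fa cc H.
  have E B : B `<=` M -> \int[area R]_(z in B) (f z ^+ 2) = \int[area R]_(z in B)
      (sine_sum a z ^+ 2).
    by move=> sB; apply: eq_Rintegral => z /set_mem /sB; rewrite box_closed_square => /fa
        ->.
  rewrite !E//; apply: le_trans H.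
  by apply: ler_wpM2r => //; apply: Rintegral_ge0 => z _; exact: sqr_ge0.
pose N := (Num.truncn lambda).+1.
have lN : lambda < N%:R by exact: truncnS_gt.
have [a [Ha fa]] := dirichlet_sine_sum lambda f N Hf lN.
have m1 : Num.min c1 c2 <= c1 by rewrite ge_min lexx.
have m2 : Num.min c1 c2 <= c2 by rewrite ge_min lexx orbT.
have [/existsP[p ap]|/existsPn a0] := boolP [exists p, a p != 0]; last first.
  apply: (red _ _ c1 fa m1); apply: (high _ _ Lam.+1) => // p.
  by have := a0 p; rewrite negbK => ->.
have lE := Ha p ap.
have [LL|LL] := ltnP Lam (p.1.+1 ^ 2 + p.2.+1 ^ 2).
  apply: (red _ _ c1 fa m1); apply: (high _ _ _ LL) => q /Ha.
  by rewrite -lE => /eqP; rewrite eqr_nat => /eqP.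
have lN0 : lambda < Lam.+1%:R by rewrite -lE ltr_nat ltnS.
have [a' [_ fa']] := dirichlet_sine_sum lambda f Lam.+1 Hf lN0.
exact: (red _ _ c2 fa' m2 (low a')).
Qed.

End expansion.

(** * Quantum limits *)

Section main_results.
Context {R : realType}.
Local Notation M := (box (0:R) pi 0 pi).

Lemma sqmodE (z : R[i]) : sqmod z = complex.Re z ^+ 2 + complex.Im z ^+ 2.
Proof. by case: z => a b; rewrite /sqmod /= sqr_sqrtr// addr_ge0 ?sqr_ge0. Qed.

(** [G] is a globally continuous version of the squared modulus, which frees
    the later integrals from measurability questions about [phi]. *)
Lemma eigenfunction_lower (x0 y0 d : R) :
  0 < d -> 0 <= x0 - d -> x0 + d <= pi -> 0 <= y0 - d -> y0 + d <= pi ->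
  exists2 c : R, 0 < c & forall lambda phi, dirichlet_eigenfunction lambda phi ->
    exists G : R * R -> R, [/\ continuous G, forall z, 0 <= G z,
      forall z, closed_square R z -> sqmod (phi z) = G z &
      c * \int[area R]_(z in M) G z <=
      \int[area R]_(z in box (x0 - d) (x0 + d) (y0 - d) (y0 + d)) G z].
Proof.
move=> d0 hx1 hx2 hy1 hy2; have p0 := @pi_ge0 R.
have [c c0 Hc] := real_dirichlet_lower x0 y0 d d0 hx1 hx2 hy1 hy2.
have BM : box (x0 - d) (x0 + d) (y0 - d) (y0 + d) `<=` M.
  by apply: subset_box; lra.
exists c => // lambda phi [[cre cim] [C2re C2im] eig bd _].
pose f1 z := complex.Re (phi z); pose f2 z := complex.Im (phi z).
have D1 : real_dirichlet lambda f1.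
  split; [exact: cre|exact: C2re|by move=> p /eig[]|].
  by move=> p /bd; rewrite /f1 => ->.
have D2 : real_dirichlet lambda f2.
  split; [exact: cim|exact: C2im|by move=> p /eig[]|].
  by move=> p /bd; rewrite /f2 => ->.
pose F1 := f1 \o box_clamp 0 pi 0 pi; pose F2 := f2 \o box_clamp 0 pi 0 pi.
have cF1 : continuous F1 by exact: box_clamp_continuous.
have cF2 : continuous F2 by exact: box_clamp_continuous.
have E1 B : B `<=` M -> \int[area R]_(z in B) (f1 z ^+ 2) = \int[area R]_(z in B) (F1 z
    ^+ 2).
  by move=> sB; apply: eq_Rintegral => z /set_mem/sB Mz; rewrite /F1 /= box_clamp_id.
have E2 B : B `<=` M -> \int[area R]_(z in B) (f2 z ^+ 2) = \int[area R]_(z in B) (F2 z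
    ^+ 2).
  by move=> sB; apply: eq_Rintegral => z /set_mem/sB Mz; rewrite /F2 /= box_clamp_id.
exists (fun z => F1 z ^+ 2 + F2 z ^+ 2); split.
- by cont.
- by move=> z; rewrite addr_ge0 ?sqr_ge0.
- by move=> z; rewrite -box_closed_square => Mz; rewrite sqmodE /F1 /F2 /= box_clamp_id.
- rewrite !box_intD; do ?[by cont].
  rewrite mulrDr; apply: lerD.
    by have := Hc _ _ D1; rewrite !E1.
  by have := Hc _ _ D2; rewrite !E2.
Qed.

Lemma exists_box (omega : set (R * R)) : open omega -> omega !=set0 ->
  omega `<=` open_square R ->
  exists x0 y0 d : R, [/\ 0 < d,
    [/\ 0 <= x0 - d, x0 + d <= pi, 0 <= y0 - d & y0 + d <= pi] &
    box (x0 - d) (x0 + d) (y0 - d) (y0 + d) `<=` omega].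
Proof.
move=> oo [[x0 y0] oz] osq.
have /nbhs_ballP[e /= e0 He] : nbhs (x0, y0) omega.
  by rewrite openE in oo; exact: oo.
have Bo : box (x0 - e / 2) (x0 + e / 2) (y0 - e / 2) (y0 + e / 2) `<=` omega.
  move=> [x y] [] /=; rewrite !in_itv /= => /andP[? ?] /andP[? ?]; apply: He.
  by split; rewrite /ball /= ltr_norml; apply/andP; split; lra.
exists x0, y0, (e / 2); split => //; first by rewrite divr_gt0.
have h1 : open_square R (x0 - e / 2, y0 - e / 2).
  by apply/osq/Bo; split; rewrite /= in_itv /=; apply/andP; split; lra.
have h2 : open_square R (x0 + e / 2, y0 + e / 2).
  by apply/osq/Bo; split; rewrite /= in_itv /=; apply/andP; split; lra.
case: h1 => /= /andP[? ?] /andP[? ?]; case: h2 => /= /andP[? ?] /andP[? ?].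
by split; rewrite ltW.
Qed.

Lemma open_square_open : open (open_square R).
Proof.
have -> : open_square R =
    (fst @^-1` [set x | 0 < x < pi]) `&` (snd @^-1` [set x | 0 < x < pi]) by [].
have o1 : open [set x : R | 0 < x < pi].
  rewrite (_ : [set x | _] = `]0, pi[%classic); first exact: interval_open.
  by apply/seteqP; split => x; rewrite /= in_itv.
apply: openI.
  by move/continuousP: (@fst_cont R); apply.
by move/continuousP: (@snd_cont R); apply.
Qed.

(** A homothety of ratio close to [1] moves a boundary point inside the square
    by less than any given distance. *)
Lemma relatively_open_meets (U : set (R * R)) : open U ->
  (closed_square R `&` U) !=set0 -> (open_square R `&` U) !=set0.
Proof.
move=> oU [[x y] [[/= hx hy] Uxy]].
have /nbhs_ballP[e /= e0 He] : nbhs (x, y) U.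
  by rewrite openE in oU; exact: oU.
have p0 := @pi_gt0 R.
pose s := Num.min (1 / 2) (e / (2 * pi)).
have s0 : 0 < s by rewrite lt_min !divr_gt0 ?mulr_gt0.
have s1 : s <= 1 / 2 by rewrite ge_min lexx.
have s2 : s * pi < e.
  have : s <= e / (2 * pi) by rewrite ge_min lexx orbT.
  rewrite ler_pdivlMr ?mulr_gt0//; nra.
clearbody s.
have r01 : 0 < 1 - s < 1 by apply/andP; split; lra.
exists (dil (1 - s) x, dil (1 - s) y); split.
  by split; apply: dil_in.
have near (t : R) : 0 <= t <= pi -> `|t - dil (1 - s) t| < e.
  move=> /andP[? ?]; apply: le_lt_trans s2.
  have -> : t - dil (1 - s) t = s * (t - pi / 2) by rewrite /dil; ring.
  rewrite normrM gtr0_norm// ler_pM2l// ler_norml; apply/andP; split; lra.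
by apply: He; split; rewrite /ball /=; exact: near.
Qed.

Lemma Rintegral_rho (g : R * R -> R) : continuous g -> (forall z, 0 <= g z) ->
  \int[rho R]_(z in M) g z = (pi ^+ 2)^-1 * \int[area R]_(z in M) g z.
Proof.
move=> cg g0; rewrite /Rintegral /rho ge0_integral_mscale//=.
- rewrite fineM//; apply: integrable_fin_num; first exact: measurable_box.
  exact: box_integrable.
- exact: measurable_box.
- apply: measurableT_comp => //; apply: measurable_funTS.
  exact: plane_continuous_measurable.
- by move=> z _; rewrite lee_fin.
Qed.

(** A continuous function [f] between the indicators of a small box and of
    [omega] has integral at least [c] against every normalized eigenfunction,
    hence at least [c / 2] against every closure point. *)
Lemma local_quantum_limit_lower (omega U : set (R * R)) : open U ->
  omega = closed_square R `&` U -> omega !=set0 ->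
  exists2 c : R, 0 < c & forall mu, local_quantum_limit mu -> (c%:E <= mu omega)%E.
Proof.
move=> oU oE o0; have p0 := @pi_gt0 R.
have [x0 [y0 [d [d0 [hx1 hx2 hy1 hy2] BU]]]] : exists x0 y0 d : R, [/\ 0 < d,
    [/\ 0 <= x0 - d, x0 + d <= pi, 0 <= y0 - d & y0 + d <= pi] &
    box (x0 - d) (x0 + d) (y0 - d) (y0 + d) `<=` open_square R `&` U].
  apply: exists_box; last by move=> z [].
    by apply: openI => //; exact: open_square_open.
  by apply: relatively_open_meets => //; rewrite -oE.
have [c c0 Hc] := @eigenfunction_lower x0 y0 (d / 2) ltac:(lra) ltac:(lra) ltac:(lra)
    ltac:(lra) ltac:(lra).
have BM : box (x0 - d / 2) (x0 + d / 2) (y0 - d / 2) (y0 + d / 2) `<=` M.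
  by apply: subset_box; lra.
exists (c / 2) => [|mu [mu1 muH]]; first by rewrite divr_gt0.
(* a tent equal to 1 near (x0, y0) and supported in U *)
pose T (t : R) := clamp 0 1 (2 - 2 * `|t| / d).
have cn : continuous (fun t : R => `|t|) by move=> u; exact: norm_continuous.
have cT : continuous T.
  by apply: (@cont_comp _ R (fun t => 2 - 2 * `|t| / d) (clamp 0 1)); [cont|exact:
      clamp_cont].
have T01 t : 0 <= T t <= 1 by exact: clamp_itv.
have T1 t : `|t| <= d / 2 -> T t = 1.
  move=> td; have h : 2 * `|t| / d <= 1 by rewrite ler_pdivrMr// mul1r; lra.
  by rewrite /T /clamp min_r ?max_r//; lra.
have T0 t : T t != 0 -> `|t| <= d.
  move=> Tt; rewrite leNgt; apply: contraNN Tt => dt.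
  have h : 2 <= 2 * `|t| / d by rewrite ler_pdivlMr//; lra.
  by rewrite /T /clamp; apply/eqP; rewrite max_l//; rewrite ge_min; apply/orP; left; lra.
pose f (z : R * R) := T (z.1 - x0) * T (z.2 - y0).
have cf : continuous f.
  have c1 (t : R) : continuous (fun x => T (x - t)).
    by apply: (@cont_comp _ R (fun x => x - t) T) => //; cont.
  by apply: contM; [exact: (cont_fst (fun x => T (x - x0)))|exact: (cont_snd (fun x => T
      (x - y0)))].
have f0 z : 0 <= f z by rewrite /f mulr_ge0//; [case/andP: (T01 (z.1 - x0))|case/andP:
    (T01 (z.2 - y0))].
have f1 z : f z <= 1.
  have /andP[a1 a2] := T01 (z.1 - x0); have /andP[b1 b2] := T01 (z.2 - y0).
  by rewrite /f mulr_ile1.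
have fo z : f z != 0 -> omega z.
  case: z => x y; rewrite /f /= mulf_eq0 negb_or => /andP[/T0 h1 /T0 h2].
  move: h1 h2; rewrite !ler_distl => h1 h2.
  have [|[/= /andP[? ?] /andP[? ?]] Uz] := BU (x, y).
    by split; rewrite /= in_itv.
  by rewrite oE; split => //; split; rewrite /= !ltW.
have [lambda [phi [_ eig norm1 close]]] := muH 0 1%N (fun=> f) (c / 2)
  (fun _ => continuous_subspaceT cf) ltac:(by rewrite divr_gt0).
have [G [cG G0 GE Hlow]] := Hc _ _ eig.
have kp : 0 < (pi ^+ 2)^-1 :> R by rewrite invr_gt0 exprn_gt0.
have IG : (pi ^+ 2)^-1 * \int[area R]_(z in M) G z = 1.
  rewrite -Rintegral_rho// box_closed_square /Rintegral.
  transitivity (fine (\int[rho R]_(z in closed_square R) (sqmod (phi z))%:E)%E).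
    by congr fine; apply: eq_integral => z /set_mem zM; rewrite GE.
  by rewrite norm1.
have If : c <= \int[rho R]_(z in closed_square R) (f z * sqmod (phi z)).
  have -> : \int[rho R]_(z in closed_square R) (f z * sqmod (phi z)) =
      (pi ^+ 2)^-1 * \int[area R]_(z in M) (f z * G z).
    rewrite -Rintegral_rho; [|by cont|by move=> z; rewrite mulr_ge0].
    by rewrite box_closed_square; apply: eq_Rintegral => z /set_mem zM; rewrite GE.
  rewrite -[X in X <= _]mulr1 -IG mulrCA ler_pM2l//; apply: le_trans Hlow _.
  set B := box _ _ _ _.
  have -> : \int[area R]_(z in B) G z = \int[area R]_(z in B) (f z * G z).
    apply: eq_box_int => -[x y] [] /=; rewrite !in_itv /= -!ler_distl => hx hy.
    by rewrite /f /= !T1 ?mul1r.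
  apply: Rintegral_le_subset.
  - exact: measurable_box.
  - exact: measurable_box.
  - by apply: box_integrable; cont.
  - exact: BM.
  - by move=> z _ _; rewrite mulr_ge0.
have Imu : c / 2 <= \int[mu]_(z in closed_square R) f z.
  move: (close ord0) If; rewrite /=; move: (Rintegral _ _ _) (Rintegral _ _ _) => A B.
  by clear; rewrite ltr_norml => /andP[_]; lra.
have mM : measurable (closed_square R : set (plane R)) by rewrite -box_closed_square;
    exact: measurable_box.
have mo : measurable (omega : set (plane R)).
  by rewrite oE; apply: measurableI => //; exact: plane_open_measurable.
have mf : measurable_fun setT (f : plane R -> R) by exact: plane_continuous_measurable.
have intf : mu.-integrable (closed_square R) (EFin \o f).
  apply: measurable_bounded_integrable => //.
  - apply: le_lt_trans (ltry 1); rewrite le_eqVlt; apply/orP; left; apply/eqP.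
    exact: mu1.
  - exact: measurable_funTS.
  - exists 1; split; first exact: num_real.
    by move=> K K1 z _ /=; rewrite ger0_norm// (le_trans (f1 z))// ltW.
apply: (@le_trans _ _ (\int[mu]_(z in closed_square R) (f z)%:E)%E).
  by rewrite -[X in (_ <= X)%E]fineK ?lee_fin//; exact: integrable_fin_num.
apply: (@le_trans _ _ (\int[mu]_(z in closed_square R) (\1_omega z)%:E)%E).
  apply: ge0_le_integral => //.
  - by move=> z _; rewrite lee_fin.
  - by apply: measurableT_comp => //; exact: measurable_funTS.
  - by apply: measurableT_comp => //; exact: measurable_indic.
  - move=> z _; rewrite lee_fin indicE.
    have [->|/fo oz] := eqVneq (f z) 0; first by [].
    by rewrite mem_set.
by rewrite integral_indic// setIidl// oE; exact: subIsetl.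
Qed.

End main_results.

Theorem lemma1 (R : realType) :
  (forall omega : set (R * R),
     open omega -> omega !=set0 -> omega `<=` open_square R ->
     exists2 C : R, 0 < C &
       forall (lambda : R) (phi : R * R -> R[i]),
         dirichlet_eigenfunction lambda phi ->
         (C%:E * \int[area R]_(p in closed_square R) (sqmod (phi p))%:E
            <= \int[area R]_(p in omega) (sqmod (phi p))%:E)%E) /\
  (forall omega : set (R * R),
     (exists2 U : set (R * R), open U & omega = closed_square R `&` U) ->
     omega !=set0 ->
     (0 < ereal_inf [set (mu : probability (plane R) R) omega
                       | mu in quantum_limits R])%E).
Proof.
split=> [omega oo o0 osq|omega [U oU oE] o0]; last first.
  have [c c0 Hc] := local_quantum_limit_lower omega U oU oE o0.
  apply: (@lt_le_trans _ _ c%:E); first by rewrite lte_fin.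
  by apply: le_ereal_inf_tmp => _ [mu Hmu <-]; exact: Hc.
have [x0 [y0 [d [d0 [hx1 hx2 hy1 hy2] Bo]]]] := exists_box omega oo o0 osq.
have [c c0 Hc] := eigenfunction_lower x0 y0 d d0 hx1 hx2 hy1 hy2.
exists c => // lambda phi eig.
have [G [cG G0 GE Hlow]] := Hc _ _ eig.
have oM : omega `<=` closed_square R.
  move=> z /osq [] /andP[? ?] /andP[? ?]; by split; rewrite !ltW.
have E (D : set (R * R)) : D `<=` closed_square R ->
    (\int[area R]_(p in D) (sqmod (phi p))%:E = \int[area R]_(p in D) (G p)%:E)%E.
  by move=> sD; apply: eq_integral => z /set_mem/sD/GE ->.
have fin a b a' b' : (\int[area R]_(p in box a b a' b') (G p)%:E)%E =
    (\int[area R]_(p in box a b a' b') G p)%:E.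
  rewrite /Rintegral fineK//; apply: integrable_fin_num; first exact: measurable_box.
  exact: box_integrable.
rewrite !E// -box_closed_square fin -EFinM.
apply: (@le_trans _ _ (\int[area R]_(p in box (x0 - d) (x0 + d) (y0 - d) (y0 + d)) (G
    p)%:E)%E).
  by rewrite fin lee_fin.
apply: ge0_subset_integral => //.
- exact: measurable_box.
- exact: plane_open_measurable.
- apply: measurableT_comp => //; apply: measurable_funTS.
  exact: plane_continuous_measurable.
- by move=> z _; rewrite lee_fin.
Qed.
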